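(* Let $\{\omega_{\mathbf z}\}_{\mathbf z\in\mathbb Z^2}$ be i.i.d. non-negative random variables with continuous cumulative distribution function, such that $\mathbb E[e^{\alpha\omega_{\mathbf z}}]<\infty$ for some $\alpha>0$ and $\mathbb P(\omega_{\mathbf z}>\beta)>0$ for all $\beta<\infty$. Fix $0<t\le 1/2$ such that $\mu_0>\mu_t$. Then for each $\epsilon>0$ there exists a constant $n_0$ such that for each even integer $n\ge n_0$, $$e^{-2n(\mathcal J_t(\mu_0)+\epsilon)}\le \mathbb P\big(\mathrm{Mid}_{0,n}\cdot\mathbf e_1=\lfloor n/2+tn\rfloor\big)\le \mathbb P\big(\mathrm{Mid}_{0,n}\cdot\mathbf e_1\ge\lfloor n/2+tn\rfloor\big)\le e^{-2n(\mathcal J_t(\mu_0)-\epsilon)}.$$ Consequently, with limits along even integers $n$, $$2\mathcal J_t(\mu_0)=-\lim_{n\to\infty}\frac1n\log\mathbb P\big(\mathrm{Mid}_{0,n}\cdot\mathbf e_1=\lfloor n/2+tn\rfloor\big)=-\lim_{n\to\infty}\frac1n\log\mathbb P\big(\mathrm{Mid}_{0,n}\cdot\mathbf e_1\ge\lfloor n/2+tn\rfloor\big).$$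
   Context: Let $\mathbf e_1,\mathbf e_2$ be the standard basis vectors of $\mathbb R^2$ and $\mathbf 0=(0,0)$. For coordinatewise-ordered points $\mathbf u\le\mathbf v$ in $\mathbb Z^2$, an up-right path from $\mathbf u$ to $\mathbf v$ is a finite sequence $\gamma=(\gamma_i)_{i=0}^{|\mathbf u-\mathbf v|_1}$ in $\mathbb Z^2$ with $\gamma_0=\mathbf u$, $\gamma_{|\mathbf u-\mathbf v|_1}=\mathbf v$ and $\gamma_{i+1}-\gamma_i\in\{\mathbf e_1,\mathbf e_2\}$. The last-passage value is $$G_{\mathbf u,\mathbf v}=\max_{\gamma:\mathbf u\to\mathbf v\text{ up-right}}\ \sum_{\mathbf z\in\gamma\setminus\{\mathbf u\}}\omega_{\mathbf z},$$ with $G_{\mathbf u,\mathbf v}=-\infty$ if there is no up-right path from $\mathbf u$ to $\mathbf v$. A maximizing path is called a geodesic; it is almost surely unique because the weights are continuous. $\mathrm{Mid}_{0,n}$ denotes the midpoint of the geodesic from $(0,0)$ to $(n,n)$, i.e. the random point at which this geodesic meets the line $\{(x,y)\in\mathbb R^2:x+y=n\}$. For $-1/2\le t\le1/2$, the shape function is the almost sure (deterministic) limit $$\mu_t=\lim_{n\to\infty}\frac{G_{\mathbf 0,(\lfloor n/2+tn\rfloor,\lfloor n/2-tn\rfloor)}}{n},$$ and for $r>0$ the right tail large deviation rate function is $$\mathcal J_t(r)=-\lim_{n\to\infty}\frac1n\log\mathbb P\big(G_{\mathbf 0,(\lfloor n/2+tn\rfloor,\lfloor n/2-tn\rfloor)}\ge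 rn\big);$$ both limits exist, and $\mathcal J_t(r)\in[0,\infty)$. *)

(* Defs.v *)
From HB Require Import structures.
From mathcomp Require Import all_boot all_order all_algebra.
From mathcomp Require Import all_classical all_reals all_analysis.
Set Implicit Arguments.
Unset Strict Implicit.
Unset Printing Implicit Defensive.
Import Order.TTheory GRing.Theory Num.Theory.
Import numFieldNormedType.Exports.
Local Open Scope classical_set_scope.
Local Open Scope ring_scope.

Definition e1 : int * int := (1, 0).
Definition e2 : int * int := (0, 1).
Definition origin : int * int := (0, 0).

Definition up_right_step : rel (int * int) :=
  fun x y => (y - x) \in [:: e1; e2].

(* A path is stored without its starting point: [p] encodes the vertex
   sequence [u :: p].  Since every step increases the sum of the coordinates
   by one, the size of [p] is the l1-distance from [u] to [v]. *)
Definition up_right_path (u v : int * int) (p : seq (int * int)) : bool :=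
  path up_right_step u p && (last u p == v).

Section last_passage.
Context {R : realType}.
Implicit Type om : int * int -> R.

(* As the starting point is not in [p], its weight is not counted. *)
Definition path_weight om (p : seq (int * int)) : R := \sum_(z <- p) om z.

(* The supremum of a finite set, hence a maximum when there is a path from
   [u] to [v]; it is [-oo] otherwise, because [ereal_sup set0 = -oo]. *)
Definition last_passage om (u v : int * int) : \bar R :=
  ereal_sup [set (path_weight om p)%:E | p in [set p | up_right_path u v p]].

Definition is_geodesic om (u v : int * int) (p : seq (int * int)) : Prop :=
  up_right_path u v p /\ (path_weight om p)%:E = last_passage om u v.

(* [xget] picks a geodesic as a function of the set of all geodesics only, so
   ties (a null event for continuous weights) are broken in a measurable way. *)
Definition geodesic om (u v : int * int) : seq (int * int) :=
  xget [::] [set p | is_geodesic om u v p].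

Definition mid om (n : nat) : int * int :=
  xget origin [set z | z \in origin :: geodesic om origin (n%:Z, n%:Z) /\
                  z.1 + z.2 = n%:Z].

Definition endpoint (t : R) (n : nat) : int * int :=
  (Num.floor (n%:R / 2 + t * n%:R), Num.floor (n%:R / 2 - t * n%:R)).

End last_passage.

Section random_weights.
Context {d : measure_display} {T : measurableType d} {R : realType}.
Variable P : probability T R.

Definition mutually_independent (I : eqType) (X : I -> {RV P >-> R}) : Prop :=
  forall (s : seq I) (A : I -> set R), uniq s ->
    (forall i, measurable (A i)) ->
    P (\bigcap_(i in [set` s]) (X i @^-1` A i)) =
    (\prod_(i <- s) P (X i @^-1` A i))%E.

Definition identically_distributed (I : Type) (X : I -> {RV P >-> R}) : Prop :=
  forall (i j : I) (A : set R), measurable A ->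
    distribution P (X i) A = distribution P (X j) A.

Variable w : int * int -> {RV P >-> R}.

Definition weights (x : T) : int * int -> R := fun z => w z x.

Definition is_shape_function (mu : R -> R) : Prop :=
  forall t : R, - 2^-1 <= t <= 2^-1 ->
    {ae P, forall x,
      ((n%:R^-1)%:E * last_passage (weights x) origin (endpoint t n))%E
        @[n --> \oo] --> (mu t)%:E}.

(* [lne] is the extended logarithm, with [lne 0 = -oo]. *)
Definition is_upper_tail_rate (J : R -> R -> R) : Prop :=
  forall t r : R, - 2^-1 <= t <= 2^-1 -> 0 < r ->
    (- ((n%:R^-1)%:E *
        lne (P [set x | ((r * n%:R)%:E <=
                         last_passage (weights x) origin (endpoint t n))%E])))%E
      @[n --> \oo] --> (J t r)%:E.

End random_weights.

(* Main.v *)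
Require Import Defs.
From HB Require Import structures.
From mathcomp Require Import all_boot all_order all_algebra.
From mathcomp Require Import all_classical all_reals all_analysis.
From mathcomp Require Import zify ring lra.
Set Implicit Arguments.
Unset Strict Implicit.
Unset Printing Implicit Defensive.
Import Order.TTheory GRing.Theory Num.Theory.
Import numFieldNormedType.Exports.
Local Open Scope classical_set_scope.
Local Open Scope ring_scope.

(** For the midpoint of the geodesic from the origin to [(n, n)] to sit at
    [z = (n/2 + tn, n/2 - tn)], the passages from the origin to [z] and from
    [z] to [(n, n)] must together weigh as much as the unconstrained passage,
    that is about [2 n mu_0]. Both are passages in the slow direction [t] (the
    second one after a transposition), they use disjoint sets of weights, and
    the cheapest way to reach the total is that each one weighs [n mu_0]. This
    costs [exp (- n J_t(mu_0))] twice.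

    Everything is done with events: an event is a set of weight configurations
    that belongs to the sigma-algebra of the sites it looks at ([depends]),
    events that look at disjoint sets of sites are independent ([Pr_indep]),
    and the law of the weights is invariant under injective relabellings of the
    sites ([Pr_relabel]). The basic event [LP r u v] says that some path from
    [u] to [v] weighs at least [r]. Concatenating paths makes its probability
    supermultiplicative ([Pr_LP_cat]), which gives the midpoint convexity,
    hence the continuity, of [J_t] ([rate_continuous]), and shows that no
    direction is faster than the diagonal ([Pr_LP_small]).

    Upper bound. By reflection the sum over all midpoints to the right of [z]
    and all values of the two halves is avoided: a geodesic whose midpoint is to
    the right of [z] crosses the diagonal line through [z], and transposing it
    after a crossing turns it into a path from the origin to [2 z] of the same
    weight in a configuration of the same law ([Pr_mid_ge]). There are at most
    [n + 1] crossing points, and a passage to [2 z] of weight close to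
    [2 n mu_0] has probability [exp (- 2 n J_t(mu_0))] up to subexponential
    factors. It remains to exclude that the geodesic weighs less than
    [2 n (mu_0 - e)]. This is superexponentially unlikely ([diag_lower_tail]):
    cut the square into blocks of a large fixed side, each of which has its
    typical value or more except with a tiny probability. For any number [K] of
    disjoint diagonal corridors of blocks, a fixed fraction of the blocks of
    all [K] corridors must fail.

    Lower bound. Cut the way from the origin through [z] to [(n, n)] into a
    large but fixed number of blocks, except for a short middle part around
    [z]. Ask that each block contains a passage of speed [r] slightly above
    [mu_0], and that along one path through the middle part all weights exceed
    a large constant [K]. The first condition costs about
    [exp (- 2 n J_t(r))], the second one an exponential of a small multiple of
    [n], as the weights are unbounded. Given a path from the origin to [(n, n)]
    that avoids [z], let [u] and [v] be the last site of the corridor before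
    the antidiagonal of [z] and the first one after it. Between [u] and [v] the
    path only sees weights off the corridor, which are independent of those
    two conditions. With probability at least one half all such bypasses are
    worse than the way from [u] through [z] to [v] inside the corridor: the long
    ones, of which there are boundedly many up to monotonicity, because typical
    speeds are at most [mu_0], and the short ones by a Chernoff bound and the
    choice of [K] ([Pr_clear]). Then every geodesic passes through [z]
    ([geodesic_through_z]), and independence concludes ([Pr_mid_eq]). *)

(** * Events determined by the weights of a set of sites *)

Section depends_on.
Context {R : realType}.
Local Notation config := (int * int -> R).
Implicit Types (S : set (int * int)) (A : set config).

Definition coord_events S : set (set config) :=
  [set C | exists z B, [/\ S z, measurable B & C = [set om | B (om z)]]].

(** Independence and symmetry concern the law of the whole configuration, so
    events live on configurations; [S] is a set of sites that determines [A]. *)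
Definition depends S A := <<s coord_events S >> A.

Lemma depends_coord S z (B : set R) :
  S z -> measurable B -> depends S [set om | B (om z)].
Proof. by move=> Sz mB; apply: sub_sigma_algebra; exists z, B. Qed.

Lemma depends_mono S1 S2 A : S1 `<=` S2 -> depends S1 A -> depends S2 A.
Proof.
move=> S12; apply: sub_sigma_algebra2 => _ [z [B [Sz mB ->]]].
by exists z, B; split => //; exact: S12.
Qed.

Lemma dependsE S A :
  depends S A = @measurable _ (g_sigma_algebraType (coord_events S)) A.
Proof. by []. Qed.

Lemma dependsC S A : depends S A -> depends S (~` A).
Proof. by rewrite !dependsE; exact: measurableC. Qed.

Lemma dependsT S : depends S setT.
Proof. by rewrite dependsE; exact: measurableT. Qed.

Lemma dependsI S A B : depends S A -> depends S B -> depends S (A `&` B).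
Proof. by rewrite !dependsE; exact: measurableI. Qed.

Lemma dependsU S A B : depends S A -> depends S B -> depends S (A `|` B).
Proof. by rewrite !dependsE; exact: measurableU. Qed.

Lemma depends_ex S (I : countType) (Q : set I) (A : I -> set config) :
  (forall i, Q i -> depends S (A i)) -> depends S (\bigcup_(i in Q) A i).
Proof.
move=> dA; rewrite bigcup_mkcond dependsE.
apply: countable_bigcupT_measurable; first exact: countableP.
by move=> i; case: ifPn => [/set_mem Qi|_]; [exact: dA|exact: measurable0].
Qed.

Lemma depends_all S (I : countType) (Q : set I) (A : I -> set config) :
  (forall i, Q i -> depends S (A i)) -> depends S (\bigcap_(i in Q) A i).
Proof.
move=> dA; rewrite -[X in depends S X]setCK setC_bigcap.
by apply: dependsC; apply: depends_ex => i /dA; exact: dependsC.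
Qed.

(** It suffices to know how the coordinates transform, because preimages
    commute with complements and countable unions. *)
Lemma depends_preimage S S' (h : config -> config) A :
  (forall z B, S z -> measurable B -> depends S' [set om | B (h om z)]) ->
  depends S A -> depends S' (h @^-1` A).
Proof.
move=> hS; suff : <<s coord_events S >> `<=` [set A | depends S' (h @^-1` A)].
  by move=> /[apply].
apply: smallest_sub => [|_ [z [B [Sz mB ->]]]]; last exact: hS.
split => /=; rewrite ?dependsE.
- by rewrite preimage_set0; exact: measurable0.
- by move=> B; rewrite setTD preimage_setC; exact: dependsC.
- move=> F mF; rewrite preimage_bigcup.
  exact: (@bigcupT_measurable _ (g_sigma_algebraType (coord_events S'))
    (fun k => h @^-1` F k)).
Qed.

Lemma depends_sum S (p : seq (int * int)) r :
  [set` p] `<=` S -> depends S [set om | r <= path_weight om p].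
Proof.
move=> pS.
pose T := g_sigma_algebraType (coord_events S).
have mc (z : int * int) : S z -> measurable_fun setT (fun om : T => om z).
  by move=> Sz _ B mB; rewrite setTI; exact: depends_coord.
have mp : measurable_fun setT (fun om : T => path_weight om p).
  elim: p pS => [|z p IHp] pS.
    apply: (eq_measurable_fun (cst 0 : T -> R)); last exact: measurable_cst.
    by move=> om _; rewrite /path_weight big_nil.
  apply: (eq_measurable_fun (fun om : T => om z + path_weight om p)).
    by move=> om _; rewrite /path_weight big_cons.
  apply: measurable_realfun.measurable_funD; first by apply: mc; apply: pS; rewrite /= mem_head.
  by apply: IHp => y /= yp; apply: pS; rewrite /= inE yp orbT.
rewrite dependsE [X in measurable X](_ : _ =
  setT `&` (fun om : T => path_weight om p) @^-1` `[r, +oo[); last first.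
  by rewrite setTI; apply/seteqP; split => om; rewrite /= in_itv /= andbT.
exact: mp.
Qed.

(** Coordinate events are not stable under intersection; cylinders are, and
    they generate the same sigma-algebra. *)
Definition cylinder (s : seq (int * int)) (B : int * int -> set R) :
    set config := [set om | forall z, z \in s -> B z (om z)].

Definition cylinders S : set (set config) :=
  [set C | exists s B, [/\ uniq s, [set` s] `<=` S,
     forall z, measurable (B z) & C = cylinder s B]].

Lemma cylinders_setI S : setI_closed (cylinders S).
Proof.
move=> _ _ [s1 [B1 [u1 s1S mB1 ->]]] [s2 [B2 [u2 s2S mB2 ->]]].
pose B z := (if z \in s1 then B1 z else setT) `&` (if z \in s2 then B2 z else setT).
exists (undup (s1 ++ s2)), B; split.
- exact: undup_uniq.
- by move=> z; rewrite /= mem_undup mem_cat => /orP[/s1S|/s2S].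
- by move=> z; apply: measurableI; case: ifP.
apply/seteqP; split => om /=.
  move=> [h1 h2] z _; rewrite /B; split; case: ifPn => // zs; [exact: h1|exact: h2].
move=> h; split=> z zs.
  have := h z; rewrite mem_undup mem_cat zs => /(_ isT)[].
  by rewrite zs.
have := h z; rewrite mem_undup mem_cat zs orbT => /(_ isT)[_].
by rewrite zs.
Qed.

Lemma depends_cylinder S s B : [set` s] `<=` S -> (forall z, measurable (B z)) ->
  depends S (cylinder s B).
Proof.
move=> sS mB.
rewrite (_ : cylinder s B = \bigcap_(z in [set` s]) [set om | B z (om z)]) //.
by apply: depends_all => z zs; apply: depends_coord => //; exact: sS.
Qed.

Lemma coord_events_cylinders S : <<s coord_events S >> = <<s cylinders S >>.
Proof.
apply/seteqP; split.
  apply: sub_sigma_algebra2 => _ [z [B [Sz mB ->]]].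
  exists [:: z], (fun=> B); split => //.
  - by move=> y /=; rewrite inE => /eqP ->.
  - apply/seteqP; split=> om /=; last by apply; rewrite inE.
    by move=> Bz y; rewrite inE => /eqP ->.
apply: smallest_sub; first exact: smallest_sigma_algebra.
by move=> _ [s [B [us sS mB ->]]]; exact: depends_cylinder.
Qed.

(** Dynkin's theorem for the pi-system of cylinders. *)
Lemma depends_ind S (Q : set_system config) :
  (forall s B, uniq s -> [set` s] `<=` S -> (forall z, measurable (B z)) ->
     Q (cylinder s B)) ->
  (forall A, depends S A -> Q A -> Q (~` A)) ->
  (forall F : (set config)^nat, (forall n, depends S (F n)) ->
     trivIset setT F -> (forall n, Q (F n)) -> Q (\bigcup_n F n)) ->
  forall A, depends S A -> Q A.
Proof.
move=> Qcyl QC QU A; rewrite /depends coord_events_cylinders => dA.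
apply: (@dynkin_induction _ (g_sigma_algebraType (coord_events S))
  (cylinders S) Q) => //.
- exact: coord_events_cylinders.
- exact: cylinders_setI.
- have <- : cylinder [::] (fun=> setT) = setT :> set config.
    by apply/seteqP; split.
  by apply: Qcyl => // z; exact: measurableT.
- by move=> _ [s [B [us sS mB ->]]]; exact: Qcyl.
Qed.

End depends_on.

(** * Independence and invariance of the weights *)

Section weights_law.
Context {d : measure_display} {T : measurableType d} {R : realType}.
Variables (P : probability T R) (w : int * int -> {RV P >-> R}).
Local Notation config := (int * int -> R).
Implicit Types (S : set (int * int)) (A B : set config).

Local Notation ev A := (weights w @^-1` A).

(** Real-valued, so that estimates are plain real arithmetic; it is the
    probability of the event when the event is measurable ([PrE]). *)
Definition Pr A : R := fine (P (ev A)).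

Lemma weights_measurable S A : depends S A -> measurable (ev A).
Proof.
move: A; apply: depends_ind => [s B us sS mB|A _ mA|F _ _ mF].
- rewrite (_ : ev _ = \bigcap_(z in [set` s]) (w z @^-1` B z)); last first.
    by apply/seteqP; split.
  by apply: fin_bigcap_measurable => // z _; exact: measurable_funPTI.
- exact: measurableC.
- rewrite preimage_bigcup; apply: bigcupT_measurable => n; exact: mF.
Qed.

Lemma PrE S A : depends S A -> P (ev A) = (Pr A)%:E.
Proof.
by move=> /weights_measurable mA; rewrite /Pr fineK //; exact: fin_num_measure.
Qed.

Lemma Pr_ge0 A : 0 <= Pr A.
Proof. by rewrite fine_ge0. Qed.

Lemma Pr_setT : Pr setT = 1.
Proof. by rewrite /Pr preimage_setT probability_setT. Qed.

Lemma Pr_set0 : Pr set0 = 0.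
Proof. by rewrite /Pr preimage_set0 measure0. Qed.

Lemma Pr_setC S A : depends S A -> Pr (~` A) = 1 - Pr A.
Proof.
move=> dA; apply: EFin_inj; rewrite EFinB -!(@PrE S) //; last exact: dependsC.
by rewrite -probability_setC //; exact: weights_measurable dA.
Qed.

Lemma Pr_setD S A B : depends S A -> depends S B ->
  Pr (~` A `&` B) = Pr B - Pr (A `&` B).
Proof.
move=> dA dB; apply: EFin_inj.
rewrite EFinB -!(@PrE S) //; [|exact: dependsI|by apply: dependsI => //; exact: dependsC].
have mA := weights_measurable dA; have mB := weights_measurable dB.
rewrite !preimage_setI preimage_setC setIC -setDE measureD //.
  by rewrite setIC.
exact: (le_lt_trans (probability_le1 P mB) (ltry 1)).
Qed.

Lemma Pr_bigcup S (F : (set config)^nat) : (forall n, depends S (F n)) ->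
  trivIset setT F -> (Pr (\bigcup_n F n))%:E = (\sum_(n <oo) (Pr (F n))%:E)%E.
Proof.
move=> dF tF; rewrite -(@PrE S); last by apply: depends_ex.
rewrite preimage_bigcup measure_bigcup //=; last 2 first.
- by move=> n _; exact: weights_measurable (dF n).
- by move=> i j _ _ [x [Fi Fj]]; apply: tF => //; exists (weights w x).
rewrite (@eq_eseriesl _ _ xpredT) => [|n]; last by rewrite in_setT.
by apply: eq_eseriesr => n _; rewrite -(PrE (dF n)).
Qed.

Hypothesis w_ge0 : forall z x, 0 <= w z x.

(** It is enough to compare nonnegative configurations, since the others are
    never realized. *)
Lemma Pr_le S A B : depends S A -> depends S B ->
  (forall om, (forall z, 0 <= om z) -> A om -> B om) -> Pr A <= Pr B.
Proof.
move=> dA dB AB; rewrite -lee_fin -(PrE dA) -(PrE dB) le_measure ?inE //.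
- exact: weights_measurable dA.
- exact: weights_measurable dB.
- by move=> x /=; apply: AB => z; exact: w_ge0.
Qed.

Lemma Pr_le1 S A : depends S A -> Pr A <= 1.
Proof. by move=> dA; rewrite -Pr_setT (Pr_le dA) //; exact: dependsT. Qed.

Lemma Pr_setU S A B : depends S A -> depends S B -> Pr (A `|` B) <= Pr A + Pr B.
Proof.
move=> dA dB; rewrite -lee_fin EFinD -(PrE dA) -(PrE dB).
rewrite -(PrE (dependsU dA dB)) preimage_setU measureU2 //.
- exact: weights_measurable dA.
- exact: weights_measurable dB.
Qed.

Lemma Pr_union_bound S (I : eqType) (s : seq I) (A : I -> set config) :
  (forall i, i \in s -> depends S (A i)) ->
  Pr (\bigcup_(i in [set` s]) A i) <= \sum_(i <- s) Pr (A i).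
Proof.
elim: s => [|i s IHs] dA.
  rewrite big_nil (_ : \bigcup_(i in _) A i = set0) ?Pr_set0 //.
  by apply/seteqP; split => om // -[].
rewrite big_cons (_ : \bigcup_(j in [set` i :: s]) A j =
    A i `|` \bigcup_(j in [set` s]) A j); last first.
  apply/seteqP; split => om.
    move=> [j /=]; rewrite inE => /predU1P[->|js] Aj; first by left.
    by right; exists j.
  move=> [Ai|[j /= js Aj]]; first by exists i => //=; rewrite mem_head.
  by exists j => //=; rewrite inE js orbT.
have dU : depends S (\bigcup_(i in [set` s]) A i).
  rewrite dependsE; apply: fin_bigcup_measurable => // j js.
  by apply: dA; rewrite inE js orbT.
have di : depends S (A i) by apply: dA; rewrite mem_head.
apply: (le_trans (Pr_setU di dU)).
by rewrite lerD2l; apply: IHs => j js; apply: dA; rewrite inE js orbT.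
Qed.

Hypothesis w_indep : mutually_independent w.

Lemma Pr_cylinder (s : seq (int * int)) (B : int * int -> set R) :
  uniq s -> (forall z, measurable (B z)) ->
  Pr (cylinder s B) = \prod_(z <- s) Pr [set om | B z (om z)].
Proof.
move=> us mB; apply: EFin_inj; rewrite -(@PrE setT); last exact: depends_cylinder.
rewrite -prodEFin; under [RHS]eq_bigr => z _.
  by rewrite -(@PrE setT); [over|exact: depends_coord].
by rewrite -(w_indep us mB); congr (P _); apply/seteqP; split.
Qed.

(** Both sides are finite measures in [A], and in [B], and they agree on
    cylinders, so Dynkin's theorem applies to one event at a time. *)
Lemma Pr_indep S1 S2 A B : S1 `&` S2 = set0 -> depends S1 A -> depends S2 B ->
  Pr (A `&` B) = Pr A * Pr B.
Proof.
move=> S12 dA.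
have step S C : depends setT C ->
    (forall s D, uniq s -> [set` s] `<=` S -> (forall z, measurable (D z)) ->
       Pr (cylinder s D `&` C) = Pr (cylinder s D) * Pr C) ->
    forall E, depends S E -> Pr (E `&` C) = Pr E * Pr C.
  move=> dC hcyl; apply: depends_ind => // [E dE IH|F dF tF IH].
    rewrite (Pr_setD (depends_mono (@subsetT _ _) dE) dC) IH (Pr_setC dE).
    by rewrite mulrBl mul1r.
  have dFT n : depends setT (F n) by exact: depends_mono (dF n).
  apply: EFin_inj; rewrite setI_bigcupl (@Pr_bigcup setT); last 2 first.
  - by move=> n; exact: dependsI.
  - by move=> i j _ _ [om [[Fi _] [Fj _]]]; apply: tF => //; exists om.
  rewrite mulrC EFinM (Pr_bigcup dF tF) -nneseriesZl; last first.
    by move=> n _; rewrite lee_fin Pr_ge0.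
  by apply: eq_eseriesr => n _; rewrite IH mulrC -EFinM.
have dAT := depends_mono (@subsetT _ S1) dA.
move=> dB; rewrite setIC mulrC.
apply: (step S2) dB => // s2 D2 us2 s2S2 mD2; rewrite setIC mulrC.
apply: (step S1) dA => [|s1 D1 us1 s1S1 mD1]; first exact: depends_cylinder.
have s12 z : z \in s1 -> z \in s2 -> False.
  by move=> /s1S1 z1 /s2S2 z2; suff : (S1 `&` S2) z by rewrite S12.
pose D z := if z \in s1 then D1 z else D2 z.
have mD z : measurable (D z) by rewrite /D; case: ifP.
rewrite (_ : cylinder s1 D1 `&` _ = cylinder (s1 ++ s2) D); last first.
  apply/seteqP; split=> om /=.
    move=> [h1 h2] z; rewrite mem_cat /D; case: ifPn => [z1 _|_ /= z2]; first exact: h1.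
    exact: h2.
  move=> h; split=> z zs.
    by have := h z; rewrite mem_cat /D zs /=; apply.
  have := h z; rewrite mem_cat /D zs orbT ifN; first by apply.
  by apply/negP => /s12; apply.
rewrite !Pr_cylinder // ?cat_uniq ?us1 ?us2 /= ?andbT; last first.
  by apply/hasPn => z z2; apply/negP => /s12; apply.
rewrite big_cat /=; congr (_ * _); apply: eq_big_seq => z zs.
  by rewrite /D zs.
by rewrite /D ifN //; apply/negP => /s12; apply.
Qed.

Lemma Pr_bigcap_indep (I : eqType) (s : seq I) (S : I -> set (int * int))
    (A : I -> set config) : uniq s ->
  (forall i j, i \in s -> j \in s -> i != j -> S i `&` S j = set0) ->
  (forall i, i \in s -> depends (S i) (A i)) ->
  Pr (\bigcap_(i in [set` s]) A i) = \prod_(i <- s) Pr (A i).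
Proof.
elim: s => [|i s IHs] /=.
  move=> _ _ _; rewrite big_nil (_ : \bigcap_(i in _) A i = setT) ?Pr_setT //.
  by apply/seteqP; split.
move=> /andP[is_ us] disj dA; rewrite big_cons (_ : \bigcap_(j in _) A j =
    A i `&` \bigcap_(j in [set` s]) A j); last first.
  apply/seteqP; split => om /=.
    move=> h; split=> [|j js]; first by apply: h; rewrite /= mem_head.
    by apply: h; rewrite /= inE js orbT.
  by move=> [Ai As] j /=; rewrite inE => /predU1P[->//|]; exact: As.
rewrite (@Pr_indep (S i) (\bigcup_(j in [set` s]) S j)).
- congr (_ * _); apply: IHs => // [j k js ks|j js].
    by apply: disj; rewrite inE (js, ks) orbT.
  by apply: dA; rewrite inE js orbT.
- apply/seteqP; split=> // z [Si [j /= js Sj]].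
  suff : (S i `&` S j) z by rewrite disj ?mem_head ?inE ?js ?orbT //;
    apply: contraNneq is_ => ->.
  by [].
- by apply: dA; rewrite mem_head.
- rewrite dependsE; apply: fin_bigcap_measurable => // j js.
  apply: depends_mono (dA j _); first by move=> z Sz; exists j.
  by rewrite inE js orbT.
Qed.

Hypothesis w_id : identically_distributed w.

Lemma Pr_coord z1 z2 (B : set R) : measurable B ->
  Pr [set om | B (om z1)] = Pr [set om | B (om z2)].
Proof. by move=> mB; congr fine; exact: w_id. Qed.

(** The law of the weights is invariant under every injective relabelling of
    the sites: this yields translation and reflection invariance at once. *)
Lemma Pr_relabel (phi : int * int -> int * int) A : injective phi ->
  depends setT A -> Pr [set om : config | A (om \o phi)] = Pr A.
Proof.
move=> inj_phi.
have dphi E : depends setT E -> depends setT [set om : config | E (om \o phi)].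
  apply: (depends_preimage (h := fun om : config => om \o phi)) => z B _ mB.
  exact: (@depends_coord _ setT (phi z)).
move: A; apply: depends_ind => [s B us _ mB|A dA IH|F dF tF IH].
- pose B' y := if y \in map phi s then B (nth (0, 0) s (index y (map phi s)))
               else setT.
  have mB' y : measurable (B' y) by rewrite /B'; case: ifP.
  rewrite (_ : [set om | _] = cylinder (map phi s) B'); last first.
    apply/seteqP; split => om /= h z.
      move=> zs; rewrite /B' zs; case/mapP: zs => y ys ->.
      by rewrite index_map // nth_index //; exact: h.
    move=> zs; have := h (phi z); rewrite /B' map_f // index_map // nth_index //.
    exact.
  rewrite !Pr_cylinder ?map_inj_uniq // big_map; apply: eq_big_seq => z zs.
  rewrite (Pr_coord _ z) // /B' map_f // index_map // nth_index //.
- by rewrite (Pr_setC (dphi _ dA)) IH (Pr_setC dA).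
- rewrite (_ : [set om | _] = \bigcup_n [set om : config | F n (om \o phi)]) //.
  apply: EFin_inj; rewrite (Pr_bigcup dF tF) (@Pr_bigcup setT).
  + by apply: eq_eseriesr => n _; rewrite IH.
  + by move=> n; exact: dphi.
  + by move=> i j _ _ [om [Fi Fj]]; apply: tF => //; exists (om \o phi).
Qed.

End weights_law.

(** * Up-right paths and passage events *)

Section lattice_paths.
Local Notation site := (int * int)%type.
Implicit Types (u v x y z : site) (p q : seq site).

Definition le_site u v := (u.1 <= v.1) && (u.2 <= v.2).
Definition level z : int := z.1 + z.2.

Lemma stepE u v :
  up_right_step u v = (v == (u.1 + 1, u.2)) || (v == (u.1, u.2 + 1)).
Proof.
case: u v => [u1 u2] [v1 v2]; rewrite /up_right_step !inE /e1 /e2 /= !xpair_eqE /=.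
lia.
Qed.

Lemma le_site_refl u : le_site u u. Proof. by rewrite /le_site !lexx. Qed.

Lemma le_site_trans v u z : le_site u v -> le_site v z -> le_site u z.
Proof. rewrite /le_site; lia. Qed.

Lemma le_site_level u v : le_site u v -> level u <= level v.
Proof. rewrite /le_site /level; lia. Qed.

Lemma le_site_level_eq u v : le_site u v -> level v <= level u -> u = v.
Proof.
case: u v => [u1 u2] [v1 v2]; rewrite /le_site /level /= => h1 h2.
by congr (_, _); lia.
Qed.

Lemma upath_cat u v z p q :
  up_right_path u v p -> up_right_path v z q -> up_right_path u z (p ++ q).
Proof.
move=> /andP[pp /eqP <-] /andP[pq /eqP <-].
by rewrite /up_right_path cat_path last_cat pp pq eqxx.
Qed.

Lemma upath_split u v z p : up_right_path u v p -> z \in u :: p ->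
  exists p1 p2, [/\ p = p1 ++ p2, up_right_path u z p1 & up_right_path z v p2].
Proof.
move=> + zp; case/splitPl: zp => p1 p2 lz; rewrite /up_right_path cat_path last_cat lz.
by move=> /andP[/andP[pp1 pp2] lv]; exists p1, p2; rewrite pp1 pp2 lz lv eqxx.
Qed.

Lemma upath_cons u v x p : up_right_path u v (x :: p) =
  ((x == (u.1 + 1, u.2)) || (x == (u.1, u.2 + 1))) && up_right_path x v p.
Proof. by rewrite /up_right_path /= stepE -andbA. Qed.

Lemma upath_nil u v : up_right_path u v [::] = (u == v).
Proof. by []. Qed.

Lemma upath_size u v p : up_right_path u v p -> (size p)%:Z = level v - level u.
Proof.
elim: p u => [|x p IHp] u; first by rewrite upath_nil => /eqP ->; rewrite subrr.
rewrite upath_cons => /andP[ux /IHp].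
by move: ux => /orP[] /eqP ->; rewrite /level /=; lia.
Qed.

Lemma upath_le u v p : up_right_path u v p -> le_site u v.
Proof.
elim: p u => [|x p IHp] u; first by rewrite upath_nil => /eqP ->; exact: le_site_refl.
rewrite upath_cons => /andP[ux /IHp].
by move: ux => /orP[] /eqP ->; rewrite /le_site /=; lia.
Qed.

Lemma upath_mem u v p x : up_right_path u v p -> x \in p ->
  [/\ le_site u x, le_site x v & level u < level x].
Proof.
elim: p u => [|y p IHp] u //.
rewrite upath_cons => /andP[uy pp]; rewrite inE => /predU1P[->|xp].
  split; last by move: uy => /orP[] /eqP ->; rewrite /level /=; lia.
  - by move: uy => /orP[] /eqP ->; rewrite /le_site /=; lia.
  - exact: upath_le pp.
have [yx xv lx] := IHp _ pp xp; split => //.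
- by move: uy yx => /orP[] /eqP ->; rewrite /le_site /=; lia.
- by move: uy lx => /orP[] /eqP ->; rewrite /level /=; lia.
Qed.

Lemma upath_ex u v : le_site u v -> exists p, up_right_path u v p.
Proof.
case: u v => [u1 u2] [v1 v2]; rewrite /le_site /= => /andP[h1 h2].
have [m mE] : exists m : nat, m%:Z = v1 - u1 by exists `|v1 - u1|%N; lia.
have [n nE] : exists n : nat, n%:Z = v2 - u2 by exists `|v2 - u2|%N; lia.
have [p pp] : exists p, up_right_path (u1, u2) (v1, u2) p.
  elim: m u1 {h1} mE => [|m IHm] u1 mE.
    by exists [::]; rewrite upath_nil; apply/eqP; congr (_, _); lia.
  have [|p pp] := IHm (u1 + 1); first by lia.
  by exists ((u1 + 1, u2) :: p); rewrite upath_cons /= eqxx pp.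
have [q qq] : exists p, up_right_path (v1, u2) (v1, v2) p.
  elim: n u2 {h2 pp} nE => [|n IHn] u2 nE.
    by exists [::]; rewrite upath_nil; apply/eqP; congr (_, _); lia.
  have [|q qq] := IHn (u2 + 1); first by lia.
  by exists ((v1, u2 + 1) :: q); rewrite upath_cons /= eqxx orbT qq.
by exists (p ++ q); exact: upath_cat pp qq.
Qed.

Lemma upath_level_ex u v p n : up_right_path u v p -> level u <= n <= level v ->
  exists2 z, z \in u :: p & level z = n.
Proof.
elim: p u => [|x p IHp] u.
  rewrite upath_nil => /eqP <- ln; exists u; rewrite ?mem_head //; lia.
rewrite upath_cons => /andP[ux pp] ln.
have [->|un] := eqVneq n (level u); first by exists u; rewrite ?mem_head.
have [|z zp zn] := IHp _ pp; last by exists z => //; rewrite inE zp orbT.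
by move: ux ln un => /orP[] /eqP ->; rewrite /level /=; lia.
Qed.

(** A path visits each antidiagonal at most once. *)
Lemma upath_level_inj u v p y z : up_right_path u v p ->
  y \in u :: p -> z \in u :: p -> level y = level z -> y = z.
Proof.
move=> pp; rewrite !inE => /predU1P[->|yp] /predU1P[->|zp] //.
- by have [_ _] := upath_mem pp zp; lia.
- by have [_ _] := upath_mem pp yp; lia.
move=> yz; have [p1 [p2 [pE p1u p2v]]] := upath_split pp (mem_behead (s := u :: p) yp).
move: zp; rewrite pE mem_cat => /orP[zp1|zp2]; last first.
  by have [_ _] := upath_mem p2v zp2; lia.
have [q1 [q2 [_ q1u q2y]]] := upath_split p1u (mem_behead (s := u :: p1) zp1).
have := upath_size q2y; rewrite yz subrr; case: q2 q2y => //.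
by rewrite upath_nil => /eqP.
Qed.

Fixpoint upaths u n : seq (seq site) :=
  if n is n'.+1 then
    [seq (u.1 + 1, u.2) :: p | p <- upaths (u.1 + 1, u.2) n'] ++
    [seq (u.1, u.2 + 1) :: p | p <- upaths (u.1, u.2 + 1) n']
  else [:: [::]].

Lemma size_upaths u n : size (upaths u n) = (2 ^ n)%N.
Proof.
by elim: n u => //= n IHn u; rewrite size_cat !size_map !IHn expnS mul2n addnn.
Qed.

Lemma upathsP u n p : (p \in upaths u n) = path up_right_step u p && (size p == n).
Proof.
elim: n u p => [|n IHn] u [|x p] //=.
- by rewrite andbF.
- by rewrite mem_cat; apply/negbTE/negP => /orP[] /mapP[].
rewrite mem_cat eqSS stepE; apply/orP/andP => [[] /mapP[q]|].
- by rewrite IHn => /andP[qp qn] [-> ->]; rewrite eqxx qp qn.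
- by rewrite IHn => /andP[qp qn] [-> ->]; rewrite eqxx orbT qp qn.
move=> [/andP[/orP[] /eqP -> pp] pn]; [left|right];
  by apply/mapP; exists p => //; rewrite IHn pp.
Qed.

Lemma upaths_mem u v p : up_right_path u v p ->
  p \in upaths u `|level v - level u|%N.
Proof. by move=> pp; rewrite upathsP -(upath_size pp) /= eqxx andbT; case/andP: pp. Qed.

End lattice_paths.

Section last_passage_events.
Context {R : realType}.
Local Notation site := (int * int)%type.
Local Notation config := (site -> R).
Implicit Types (u v x y z : site) (p q : seq site) (om : config) (r s : R).

(** The event that the last-passage value from [u] to [v] is at least [r]
    ([LP_last_passage]). Stated through a path, it can be manipulated without
    mentioning suprema. *)
Definition LP r u v : set config :=
  [set om | exists2 p, up_right_path u v p & r <= path_weight om p].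

Definition nneg om := forall z, 0 <= om z.

Lemma path_weight_cat om p q : path_weight om (p ++ q) = path_weight om p + path_weight om q.
Proof. by rewrite /path_weight big_cat. Qed.

Lemma path_weight1 om z : path_weight om [:: z] = om z.
Proof. by rewrite /path_weight big_seq1. Qed.

Lemma path_weight_ge0 om p : nneg om -> 0 <= path_weight om p.
Proof. by move=> om0; rewrite /path_weight sumr_ge0. Qed.

Lemma LP_cat om r s u v z : LP r u v om -> LP s v z om -> LP (r + s) u z om.
Proof.
move=> [p pp rp] [q qq sq]; exists (p ++ q); first exact: upath_cat pp qq.
by rewrite path_weight_cat lerD.
Qed.

Lemma LP_mono om r s u v : s <= r -> LP r u v om -> LP s u v om.
Proof. by move=> sr [p pp rp]; exists p => //; exact: le_trans rp. Qed.

Lemma LP0 om u v : nneg om -> le_site u v -> LP 0 u v om.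
Proof. by move=> om0 /upath_ex[p pp]; exists p => //; exact: path_weight_ge0. Qed.

(** With nonnegative weights, prolonging a path does not decrease its weight. *)
Lemma LP_widen om r u v u' v' : nneg om -> le_site u' u -> le_site v v' ->
  LP r u v om -> LP r u' v' om.
Proof.
move=> om0 uu vv /LP_cat rv.
by rewrite -(addr0 r) -(add0r (r + 0)); apply: LP_cat (LP0 _ _) (rv _ _ (LP0 _ _)).
Qed.

Lemma LP_last om u v : nneg om -> le_site u v -> u != v -> LP (om v) u v om.
Proof.
move=> om0 /upath_ex[p pp] uv; exists p => //.
case/lastP: p pp => [|p x]; first by rewrite upath_nil (negbTE uv).
rewrite /up_right_path last_rcons => /andP[_ /eqP ->].
by rewrite -cats1 path_weight_cat {2}/path_weight big_seq1 lerDr path_weight_ge0.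
Qed.

(** The weights that a path from [u] to [v] collects: [u] itself does not
    count, so that consecutive boxes of a chain are disjoint. *)
Definition box u v : set site :=
  [set z | [/\ le_site u z, le_site z v & level u < level z]].

Lemma depends_LP r u v : depends (box u v) (LP r u v).
Proof.
rewrite (_ : LP r u v = \bigcup_(p in [set p | up_right_path u v p])
  [set om | r <= path_weight om p]) //.
apply: depends_ex => p /= pp; apply: depends_sum => z; exact: upath_mem pp.
Qed.

Lemma depends_LPT r u v : depends setT (LP r u v).
Proof. exact: depends_mono (@depends_LP _ _ _). Qed.

(** The supremum in the last-passage value is attained, as there are finitely
    many paths. *)
Lemma LP_max om u v : le_site u v ->
  exists2 p, up_right_path u v p & forall q, up_right_path u v q ->
    path_weight om q <= path_weight om p.
Proof.
move=> /upath_ex[p0 pp0].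
pose s := [seq p <- upaths u `|level v - level u|%N | up_right_path u v p].
have sP p : (p \in s) = up_right_path u v p.
  by rewrite mem_filter andb_idr // => /upaths_mem.
suff [p ps pmax] : exists2 p, p \in s & forall q, q \in s ->
    path_weight om q <= path_weight om p.
  by exists p; [rewrite -sP|move=> q qq; apply: pmax; rewrite sP].
move: pp0; rewrite -sP; elim: s {sP} p0 => // p s IHs p0 _.
case: s IHs => [|p1 s] IHs.
  by exists p => [|q]; rewrite inE // => /eqP ->.
have [|q qs qmax] := IHs p1; first exact: mem_head.
have [pq|qp] := leP (path_weight om p) (path_weight om q).
  exists q => [|q']; first by rewrite inE qs orbT.
  by rewrite inE => /predU1P[->//|]; exact: qmax.
exists p => [|q']; first exact: mem_head.
by rewrite inE => /predU1P[->//|/qmax/le_trans]; apply; exact: ltW.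
Qed.

Lemma last_passage_max om u v p : up_right_path u v p ->
  (forall q, up_right_path u v q -> path_weight om q <= path_weight om p) ->
  last_passage om u v = (path_weight om p)%:E.
Proof.
move=> pp pmax; apply/eqP; rewrite eq_le; apply/andP; split.
  by apply: ge_ereal_sup => _ [q /= /pmax qp <-]; rewrite lee_fin.
by apply: ereal_sup_ubound; exists p.
Qed.

Lemma geodesicP om u v p : is_geodesic om u v p <-> up_right_path u v p /\
  forall q, up_right_path u v q -> path_weight om q <= path_weight om p.
Proof.
split=> [[pp pG]|[pp pmax]]; last by split; rewrite ?(last_passage_max pp pmax).
split=> // q qq; rewrite -lee_fin pG.
by apply: ereal_sup_ubound; exists q.
Qed.

Lemma LP_last_passage om r u v :
  LP r u v om <-> (r%:E <= last_passage om u v)%E.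
Proof.
split=> [[p pp rp]|].
  apply: (@le_trans _ _ (path_weight om p)%:E); first by rewrite lee_fin.
  by apply: ereal_sup_ubound; exists p.
have [/(LP_max om)[p pp pmax]|uv] := boolP (le_site u v).
  by rewrite (last_passage_max pp pmax) lee_fin; exists p.
rewrite /last_passage (_ : [set p | _] = set0) ?image_set0 ?ereal_sup0 //.
by apply/seteqP; split => // p /= /upath_le; rewrite (negbTE uv).
Qed.

End last_passage_events.

(** * Symmetries and supermultiplicativity of passage probabilities *)

Section relabelling.
Context {R : realType}.
Local Notation site := (int * int)%type.
Local Notation config := (site -> R).
Implicit Types (u v x y z : site) (om : config) (r s : R).

Definition translate (a z : site) : site := (z.1 + a.1, z.2 + a.2).
Definition swap (z : site) : site := (z.2, z.1).

Lemma translate_inj a : injective (translate a).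
Proof. move=> [x1 x2] [y1 y2]; rewrite /translate /= => -[]; move=> h1 h2; congr (_, _); lia. Qed.

Lemma swapK : involutive swap. Proof. by case. Qed.

Lemma map_upath (phi : site -> site) u v p :
  (forall x y, x \in u :: p -> y \in p -> up_right_step x y ->
     up_right_step (phi x) (phi y)) ->
  up_right_path u v p -> up_right_path (phi u) (phi v) (map phi p).
Proof.
move=> hphi; rewrite /up_right_path last_map => /andP[pp /eqP ->]; rewrite eqxx andbT.
elim: p u pp hphi => //= x p IHp u /andP[ux pp] hphi.
rewrite hphi ?inE ?eqxx ?orbT //=; apply: IHp => // y z yp zp.
by apply: hphi; rewrite inE (yp, zp) ?orbT.
Qed.

Lemma path_weight_map om (phi : site -> site) p :
  path_weight (om \o phi) p = path_weight om (map phi p).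
Proof. by rewrite /path_weight big_map. Qed.

Lemma translate_step a x y :
  up_right_step x y -> up_right_step (translate a x) (translate a y).
Proof.
by rewrite !stepE => /orP[] /eqP -> /=; rewrite /translate /= !xpair_eqE; lia.
Qed.

Lemma swap_step x y : up_right_step x y -> up_right_step (swap x) (swap y).
Proof.
by rewrite !stepE => /orP[] /eqP -> /=; rewrite /swap /= !xpair_eqE; lia.
Qed.

Lemma LP_relabel (phi : site -> site) om r u v :
  (forall x y, up_right_step x y -> up_right_step (phi x) (phi y)) ->
  LP r u v (om \o phi) -> LP r (phi u) (phi v) om.
Proof.
move=> hphi [p pp rp]; exists (map phi p); last by rewrite -path_weight_map.
by apply: map_upath pp => x y _ _; exact: hphi.
Qed.

End relabelling.

Section last_passage_law.
Context {d : measure_display} {T : measurableType d} {R : realType}.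
Variables (P : probability T R) (w : int * int -> {RV P >-> R}).
Hypothesis w_ge0 : forall z x, 0 <= w z x.
Hypothesis w_indep : mutually_independent w.
Hypothesis w_id : identically_distributed w.
Local Notation site := (int * int)%type.
Local Notation config := (site -> R).
Local Notation Pr := (Pr w).
Implicit Types (u v x y z : site) (om : config) (r s : R).

Lemma Pr_LP_relabel (phi : site -> site) r u v : injective phi ->
  (forall x y, up_right_step x y -> up_right_step (phi x) (phi y)) ->
  Pr (LP r u v) <= Pr (LP r (phi u) (phi v)).
Proof.
move=> inj hphi; rewrite -(Pr_relabel w_indep w_id inj (@depends_LPT _ r u v)).
apply: (@Pr_le _ _ _ _ _ w_ge0 setT); last by move=> om _; exact: LP_relabel.
  apply: (depends_preimage (h := fun om : config => om \o phi)) (@depends_LPT _ r u v).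
  by move=> z B _ mB; exact: (@depends_coord _ setT (phi z)).
exact: depends_LPT.
Qed.

Lemma Pr_LP_translate a r u v :
  Pr (LP r (translate a u) (translate a v)) = Pr (LP r u v).
Proof.
apply/eqP; rewrite eq_le; apply/andP; split; last first.
  by apply: Pr_LP_relabel; [exact: translate_inj|exact: translate_step].
pose b : site := (- a.1, - a.2).
have -> : Pr (LP r u v) =
    Pr (LP r (translate b (translate a u)) (translate b (translate a v))).
  by congr (Pr (LP _ _ _)); rewrite /translate /= !addrK -surjective_pairing.
by apply: Pr_LP_relabel; [exact: translate_inj|exact: translate_step].
Qed.

Lemma Pr_LP_origin r u v :
  Pr (LP r u v) = Pr (LP r origin (v.1 - u.1, v.2 - u.2)).
Proof.
rewrite -(Pr_LP_translate u r origin); congr (Pr (LP _ _ _)).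
  by rewrite /translate /= !add0r -surjective_pairing.
by rewrite /translate /= !subrK -surjective_pairing.
Qed.

Lemma Pr_LP_swap r u v : Pr (LP r (swap u) (swap v)) = Pr (LP r u v).
Proof.
apply/eqP; rewrite eq_le; apply/andP; split; last first.
  by apply: Pr_LP_relabel; [exact: inv_inj swapK|exact: swap_step].
rewrite -[in leRHS](swapK u) -[in leRHS](swapK v).
by apply: Pr_LP_relabel; [exact: inv_inj swapK|exact: swap_step].
Qed.

Lemma Pr_LP_le r s u v u' v' : s <= r -> le_site u' u -> le_site v v' ->
  Pr (LP r u v) <= Pr (LP s u' v').
Proof.
move=> sr uu vv; apply: (Pr_le w_ge0 (@depends_LPT _ _ _ _) (@depends_LPT _ _ _ _)).
by move=> om om0 /(LP_mono sr); exact: LP_widen.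
Qed.

Lemma box_disjoint u v u' v' : le_site v u' -> box u v `&` box u' v' = set0.
Proof.
move=> vu; apply/seteqP; split => // z [[_ zv _] [_ _ lz]].
by move: zv vu lz; rewrite /le_site /level; lia.
Qed.

(** Supermultiplicativity: the two boxes share only the site [v], which
    belongs to the first box alone. *)
Lemma Pr_LP_cat r s u v z :
  Pr (LP r u v) * Pr (LP s v z) <= Pr (LP (r + s) u z).
Proof.
rewrite -(Pr_indep w_indep (box_disjoint _ _ (le_site_refl v))
  (@depends_LP _ _ _ _) (@depends_LP _ _ _ _)).
apply: (@Pr_le _ _ _ _ _ w_ge0 setT); last by move=> om _ []; exact: LP_cat.
  by apply: dependsI; exact: depends_LPT.
exact: depends_LPT.
Qed.

(** A passage in direction [z] followed by one in the transposed direction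
    ends on the diagonal. *)
Lemma Pr_LP_sqr r z :
  Pr (LP r origin z) ^+ 2 <= Pr (LP (2 * r) origin (level z, level z)).
Proof.
rewrite expr2 mulr_natl mulr2n -{2}(Pr_LP_swap r origin).
have -> : swap origin = origin by [].
rewrite (_ : Pr (LP r origin (swap z)) = Pr (LP r z (level z, level z))).
  exact: Pr_LP_cat.
rewrite [RHS]Pr_LP_origin /swap /level /=; congr (Pr (LP _ _ (_, _))); lia.
Qed.

Definition passes_through r u y v : set config :=
  [set om | exists p1 p2, [/\ up_right_path u y p1, up_right_path y v p2 &
     r <= path_weight om p1 + path_weight om p2]].

Lemma depends_passes r u y v : depends setT (passes_through r u y v).
Proof.
rewrite (_ : passes_through r u y v = \bigcup_(p in
  [set p | up_right_path u y p.1 /\ up_right_path y v p.2])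
  [set om | r <= path_weight om (p.1 ++ p.2)]).
  by apply: depends_ex => p /= pp; exact: depends_sum.
apply/seteqP; split => om.
  by move=> [p1 [p2 [pp1 pp2 rp]]]; exists (p1, p2) => //=; rewrite path_weight_cat.
by move=> [[p1 p2] /= [pp1 pp2]]; rewrite path_weight_cat; exists p1, p2.
Qed.

(** Reflection principle: transposing the part of a path after [y] in the
    diagonal line through [y] does not change the law of its weight. *)
Lemma Pr_passes_reflect r y v :
  Pr (passes_through r origin y v) <=
  Pr (LP r origin (v.2 + (y.1 - y.2), v.1 - (y.1 - y.2))).
Proof.
pose D := y.1 - y.2; pose refl (z : site) : site := (z.2 + D, z.1 - D).
pose phi (z : site) : site := if level z <= level y then z else refl z.
have lrefl z : level (refl z) = level z by rewrite /level /=; lia.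
have phiK : involutive phi.
  move=> z; rewrite /phi; case: (boolP (level z <= level y)) => [->//|zy].
  rewrite lrefl (negbTE zy) /refl /= addrK subrK.
  by rewrite -surjective_pairing.
rewrite -(Pr_relabel w_indep w_id (inv_inj phiK) (@depends_LPT _ r _ _)).
apply: (@Pr_le _ _ _ _ _ w_ge0 setT); first exact: depends_passes.
  apply: (depends_preimage (h := fun om : config => om \o phi)) (@depends_LPT _ _ _ _).
  by move=> z B _ mB; exact: (@depends_coord _ setT (phi z)).
move=> om om0 [p1 [p2 [pp1 pp2 rp]]].
exists (p1 ++ map refl p2).
  have yE : refl y = y.
    by rewrite [RHS]surjective_pairing /refl /D; congr (_, _); lia.
  apply: upath_cat pp1 _; rewrite -[X in up_right_path X _ _]yE.
  apply: (map_upath (phi := refl)) pp2 => a b _ _; rewrite !stepE.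
  by move=> /orP[] /eqP ->; rewrite /refl /= !xpair_eqE; lia.
rewrite path_weight_cat /path_weight big_map.
suff [-> ->] : \sum_(z <- p1) (om \o phi) z = path_weight om p1 /\
  \sum_(z <- p2) (om \o phi) (refl z) = path_weight om p2 by [].
split; apply: eq_big_seq => z zp /=; congr om.
  by have [_ zy _] := upath_mem pp1 zp; rewrite /phi ifT //; move: zy; rewrite /le_site /level; lia.
have [_ _ yz] := upath_mem pp2 zp.
have -> : refl z = phi z by rewrite /phi ifN //; lia.
exact: phiK.
Qed.

End last_passage_law.

(** * Exponential rates and vanishing probabilities *)

Lemma nat_above {R : realType} (x : R) : exists n : nat, x <= n%:R.
Proof.
exists (Num.bound `|x|); apply: (le_trans (ler_norm x)).
exact/ltW/archi_boundP.
Qed.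

Section exponential_rates.
Context {R : realType}.
Implicit Types (p : nat -> R) (a : R).

(** Unlike the limit of the normalized logarithms, two-sided bounds can be
    combined; [rate_cvg] goes back, along a subsequence. *)
Lemma rate_bounds p a : (forall n, 0 <= p n) ->
  (- ((n%:R^-1)%:E * lne (p n)%:E))%E @[n --> \oo] --> a%:E ->
  forall e, 0 < e -> exists N, forall n, (N <= n)%N ->
    expR (- (n%:R * (a + e))) <= p n <= expR (- (n%:R * (a - e))).
Proof.
move=> p0 /fine_cvgP[finp cvgp] e e0.
have /cvgrPdist_lt/(_ e e0) dist := cvgp.
have [N _ hN] : \forall n \near \oo, [/\ (0 < n)%N,
    (- ((n%:R^-1)%:E * lne (p n)%:E))%E \is a fin_num &
    `|a - fine (- ((n%:R^-1)%:E * lne (p n)%:E))%E| < e].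
  near=> n; split; [near: n; exact: nbhs_infty_gt|by near: n|by near: n].
exists N => n /hN[n0 finn distn].
have nR : 0 < n%:R :> R by rewrite ltr0n.
have pn : 0 < p n.
  rewrite lt_neqAle p0 andbT; apply: contraTN finn => /eqP <-.
  by rewrite /= lexx mulrNy gtr0_sg ?invr_gt0 // mul1e.
move: distn; rewrite lne_EFin //= => /ltr_normlP[h1 h2].
rewrite -[X in _ <= X <= _]lnK ?posrE // !ler_expR.
have -> : ln (p n) = n%:R * (n%:R^-1 * ln (p n)) by rewrite mulVKf // gt_eqF.
by rewrite -!mulrN !ler_pM2l //; apply/andP; split; lra.
Unshelve. all: by end_near. Qed.

Lemma rate_cvg (u : nat -> nat) p a : (forall n, 0 <= p n) ->
  (forall k, 0 < k -> 0 < u k)%N ->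
  (forall e, 0 < e -> exists N, forall k, (N <= k)%N ->
    expR (- ((u k)%:R * (a + e))) <= p k <= expR (- ((u k)%:R * (a - e)))) ->
  (- (((u k)%:R^-1)%:E * lne (p k)%:E))%E @[k --> \oo] --> a%:E.
Proof.
move=> p0 u0 hp.
have pos k e : expR (- ((u k)%:R * (a + e))) <= p k -> 0 < p k.
  by apply: lt_le_trans; exact: expR_gt0.
apply/fine_cvgP; split.
  have [N hN] := hp 1 ltr01; exists N => // k Nk; have /andP[/pos pk _] := hN k Nk.
  by rewrite lne_EFin.
apply/cvgrPdist_le => e e0; have [N hN] := hp e e0.
exists N.+1 => // k Nk; have := hN k (ltnW Nk); have /andP[/pos pk _] := hN k (ltnW Nk).
have nR : 0 < (u k)%:R :> R by rewrite ltr0n; apply: u0; exact: leq_ltn_trans Nk.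
rewrite -[X in _ <= X <= _]lnK ?posrE // !ler_expR -!mulrN /= (lt_geF pk) /=.
set l := ln (p k).
have -> : l = (u k)%:R * ((u k)%:R^-1 * l) by rewrite mulVKf // gt_eqF.
rewrite !ler_pM2l // mulKf ?gt_eqF // => /andP[lo hi].
by apply/ler_normlP; split; lra.
Qed.

End exponential_rates.

Section vanishing.
Context {d : measure_display} {T : measurableType d} {R : realType}.
Variable P : probability T R.

(** Almost sure convergence implies convergence in probability: the events
    [A n] are contained in decreasing events with null intersection. *)
Lemma ae_eventually_not (A : nat -> set T) : (forall n, measurable (A n)) ->
  {ae P, forall x, \forall n \near \oo, ~ A n x} ->
  forall e : R, 0 < e -> exists N, forall n, (N <= n)%N -> (P (A n) <= e%:E)%E.
Proof.
move=> mA aeA e e0.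
pose F n := \bigcup_(k in [set k | (n <= k)%N]) A k.
have mF n : measurable (F n) by apply: bigcup_measurable.
have F0 : P (\bigcap_n F n) = 0.
  apply: measure_negligible; first exact: bigcapT_measurable.
  apply: negligibleS aeA => x /= Fx [N _ hN].
  by have [k /= Nk Ak] := Fx N I; exact: (hN k).
have cvF : P \o F @ \oo --> P (\bigcap_n F n).
  apply: nonincreasing_cvg_mu => //.
  - exact: (le_lt_trans (probability_le1 P (mF 0%N)) (ltry 1)).
  - exact: bigcapT_measurable.
  - by move=> m n mn; apply/subsetPset => x [k /= nk Ak]; exists k => //=; exact: leq_trans nk.
rewrite F0 in cvF.
have /fine_cvgP[_ /cvgrPdist_le/(_ e e0)[N _ hN]] := cvF.
exists N => n Nn.
apply: (@le_trans _ _ (P (F n))).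
  by rewrite le_measure ?inE // => x Ax; exists n => /=.
have := hN n Nn; rewrite sub0r normrN /=.
rewrite -lee_fin => /(le_trans _); apply.
have fF : P (F n) \is a fin_num by exact: fin_num_measure.
by rewrite -{1}(fineK fF) lee_fin ler_norm.
Qed.

End vanishing.

(** * The shape function and the rate function *)

Section limits.
Context {d : measure_display} {T : measurableType d} {R : realType}.
Variables (P : probability T R) (w : int * int -> {RV P >-> R}).
Hypothesis w_ge0 : forall z x, 0 <= w z x.
Hypothesis w_indep : mutually_independent w.
Hypothesis w_id : identically_distributed w.
Local Notation site := (int * int)%type.
Local Notation config := (site -> R).
Local Notation Pr := (Pr w).
Implicit Types (u v y z : site) (om : config) (r s e : R).

Lemma LP_of_cvg om (t m : R) : (forall z, 0 <= om z) ->
  ((n%:R^-1)%:E * last_passage om origin (endpoint t n))%E @[n --> \oo] --> m%:E ->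
  forall e, 0 < e -> \forall n \near \oo,
    LP ((m - e) * n%:R) origin (endpoint t n) om /\
    ~ LP ((m + e) * n%:R) origin (endpoint t n) om.
Proof.
move=> om0 /fine_cvgP[fing cvg] e e0.
have /cvgrPdist_lt/(_ e e0) dist := cvg.
near=> n.
have nR : 0 < n%:R :> R by rewrite ltr0n; near: n; exact: nbhs_infty_gt.
have finn : ((n%:R^-1)%:E * last_passage om origin (endpoint t n))%E \is a fin_num.
  by near: n.
have : `|m - fine ((n%:R^-1)%:E * last_passage om origin (endpoint t n))%E| < e.
  by near: n.
rewrite !LP_last_passage; move: finn.
case: (last_passage _ _ _) => [g| |]; last 2 first.
- by rewrite mulry gtr0_sg ?invr_gt0 // mul1e.
- by rewrite mulrNy gtr0_sg ?invr_gt0 // mul1e.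
move=> _ /= /ltr_normlP[h1 h2]; rewrite !lee_fin.
have -> : g = (n%:R^-1 * g) * n%:R by rewrite mulrAC mulVf ?mul1r // gt_eqF.
rewrite !ler_pM2r //; split; first by lra.
by apply/negP; rewrite -ltNge; lra.
Unshelve. all: by end_near. Qed.

Variable (mu : R -> R).
Hypothesis mu_shape : is_shape_function w mu.

Lemma shape_ge0 (t : R) : - 2^-1 <= t <= 2^-1 -> 0 <= mu t.
Proof.
move=> ht; rewrite leNgt; apply/negP => mu_lt0.
have [x cvx] : exists x, ((n%:R^-1)%:E * last_passage (weights w x) origin
    (endpoint t n))%E @[n --> \oo] --> (mu t)%:E.
  apply: contrapT => /forallNP no.
  have : P setT = 0.
    apply: measure_negligible => //; apply: negligibleS (mu_shape ht) => x _.
    exact: no.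
  by rewrite probability_setT => -[/eqP]; rewrite oner_eq0.
have om0 : nneg (weights w x) by move=> z; exact: w_ge0.
have e0 : 0 < - mu t / 2 by rewrite divr_gt0 // oppr_gt0.
have [N _ hN] := LP_of_cvg om0 cvx e0.
have [n Nn n0] : exists2 n, (N <= n)%N & (0 < n)%N by exists N.+1.
have [[p pp _] h] := hN n Nn.
apply: h; exists p => //; apply: le_trans (path_weight_ge0 _ om0).
by rewrite pmulr_lle0 ?ltr0n //; lra.
Qed.

Lemma diag_endpoint (L : nat) : endpoint (0 : R) L.*2 = (L%:Z, L%:Z).
Proof.
rewrite /endpoint mul0r addr0 subr0 -muln2 natrM mulfK ?pnatr_eq0 //.
by rewrite -[_%:R]/((L%:Z)%:~R) intrKfloor.
Qed.

Lemma Pr_diag_limit e eta : 0 < e -> 0 < eta ->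
  exists N, forall L, (N <= L)%N ->
    Pr (~` LP ((mu 0 - e) * (2 * L%:R)) origin (L%:Z, L%:Z)) <= eta /\
    Pr (LP ((mu 0 + e) * (2 * L%:R)) origin (L%:Z, L%:Z)) <= eta.
Proof.
move=> e0 eta0.
have h0 : - 2^-1 <= (0 : R) <= 2^-1 by lra.
have two n : (n.*2)%:R = 2 * n%:R :> R by rewrite -mul2n natrM.
have near_ok : {ae P, forall x, \forall n \near \oo,
    LP ((mu 0 - e) * (2 * n%:R)) origin (n%:Z, n%:Z) (weights w x) /\
    ~ LP ((mu 0 + e) * (2 * n%:R)) origin (n%:Z, n%:Z) (weights w x)}.
  apply: filterS (mu_shape h0) => x cvx.
  have om0 : nneg (weights w x) by move=> z; exact: w_ge0.
  have [N _ hN] := LP_of_cvg om0 cvx e0.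
  exists N => // n Nn; have := hN n.*2; rewrite diag_endpoint two; apply => /=.
  by apply: leq_trans Nn _; rewrite -addnn leq_addr.
pose A1 n := LP ((mu 0 - e) * (2 * n%:R)) origin (n%:Z, n%:Z).
pose A2 n := LP ((mu 0 + e) * (2 * n%:R)) origin (n%:Z, n%:Z).
have mA1 n : measurable (weights w @^-1` (~` A1 n)).
  by apply: (@weights_measurable _ _ _ _ _ setT); apply: dependsC; exact: depends_LPT.
have mA2 n : measurable (weights w @^-1` (A2 n)).
  by apply: (@weights_measurable _ _ _ _ _ setT); exact: depends_LPT.
have [|N1 hN1] := @ae_eventually_not _ _ _ P _ mA1 _ _ eta0.
  by apply: filterS near_ok => x [N _ hN]; exists N => // n /hN[? _] /=; exact.
have [|N2 hN2] := @ae_eventually_not _ _ _ P _ mA2 _ _ eta0.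
  by apply: filterS near_ok => x [N _ hN]; exists N => // n /hN[].
exists (maxn N1 N2) => L; rewrite geq_max => /andP[/hN1 h1 /hN2 h2].
split; rewrite -lee_fin -(@PrE _ _ _ _ _ setT) //; last exact: depends_LPT.
by apply: dependsC; exact: depends_LPT.
Qed.

(** The square of the probability is bounded by a diagonal one, hence the bound
    is uniform in the direction. *)
Lemma Pr_LP_small e eta : 0 < e -> 0 < eta ->
  exists N : nat, forall z, N%:Z <= level z ->
    Pr (LP ((mu 0 + e) * (level z)%:~R) origin z) <= eta.
Proof.
move=> e0 eta0; have [|N hN] := @Pr_diag_limit e (eta ^+ 2) e0.
  by rewrite exprn_gt0.
exists N => z Nz; have [L LE] : exists L : nat, level z = L%:Z.
  by exists `|level z|%N; lia.
rewrite -(@ler_sqr _ (Pr _)) ?nnegrE ?Pr_ge0 ?(ltW eta0) //.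
apply: le_trans (Pr_LP_sqr w_ge0 w_indep w_id _ _) _; rewrite LE -pmulrn.
have [|_] := hN L; first by lia.
by rewrite mulrCA.
Qed.

Variable (J : R -> R -> R).
Hypothesis J_rate : is_upper_tail_rate w J.

Lemma rate_LP (t r e : R) : - 2^-1 <= t <= 2^-1 -> 0 < r -> 0 < e ->
  exists N, forall n, (N <= n)%N ->
    expR (- (n%:R * (J t r + e))) <= Pr (LP (r * n%:R) origin (endpoint t n))
      <= expR (- (n%:R * (J t r - e))).
Proof.
move=> ht r0 e0.
apply: (@rate_bounds R (fun n => Pr (LP (r * n%:R) origin (endpoint t n)))) => //.
  by move=> n; exact: Pr_ge0.
have := J_rate ht r0; apply: cvg_trans; apply: near_eq_cvg.
near=> n; rewrite -(@PrE _ _ _ _ _ setT); last exact: depends_LPT.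
congr (- (_ * lne (P _)))%E; apply/seteqP; split=> x /=.
  by move=> h; apply/LP_last_passage.
by move/LP_last_passage.
Unshelve. all: by end_near. Qed.

Lemma endpoint_double (t : R) n :
  le_site (translate (endpoint t n) (endpoint t n)) (endpoint t n.*2).
Proof.
have two : (n.*2)%:R = n%:R + n%:R :> R by rewrite -addnn natrD.
rewrite /le_site /translate /endpoint /= two !floor_ge_int !intrD.
set x := n%:R / 2 + t * n%:R; set y := n%:R / 2 - t * n%:R.
have := floor_le x; have := floor_le y.
by rewrite /x /y => h1 h2; apply/andP; split; lra.
Qed.

(** Two consecutive passages in direction [t] form one of twice the length,
    whose speed is the mean of the two speeds. *)
Lemma rate_midconvex (t r s : R) : - 2^-1 <= t <= 2^-1 -> 0 < r -> 0 < s ->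
  2 * J t ((r + s) / 2) <= J t r + J t s.
Proof.
move=> ht r0 s0; apply/ler_addgt0Pr => e e0.
have e4 : 0 < e / 4 by rewrite divr_gt0.
have m0 : 0 < (r + s) / 2 by rewrite divr_gt0 // addr_gt0.
have [N1 h1] := rate_LP ht r0 e4; have [N2 h2] := rate_LP ht s0 e4.
have [N3 h3] := rate_LP ht m0 e4.
pose n := (N1 + N2 + N3).+1.
have [n1 n2 n3] : [/\ (N1 <= n)%N, (N2 <= n)%N & (N3 <= n.*2)%N].
  by rewrite /n; split; lia.
have /andP[lo1 _] := h1 n n1; have /andP[lo2 _] := h2 n n2.
have /andP[_ hi3] := h3 _ n3.
have nR : 0 < n%:R :> R by rewrite ltr0n.
have two : (n.*2)%:R = 2 * n%:R :> R by rewrite -mul2n natrM.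
have : expR (- (n%:R * (J t r + e / 4))) * expR (- (n%:R * (J t s + e / 4)))
    <= expR (- (n.*2%:R * (J t ((r + s) / 2) - e / 4))).
  apply: le_trans hi3; apply: (le_trans (ler_pM _ _ lo1 lo2)); rewrite ?expR_ge0 //.
  rewrite -[X in _ * X](Pr_LP_translate w_ge0 w_indep w_id (endpoint t n)).
  have -> : translate (endpoint t n) origin = endpoint t n.
    by rewrite [RHS]surjective_pairing /translate /= !add0r.
  apply: (le_trans (Pr_LP_cat w_ge0 w_indep _ _ _ _ _)).
  apply: (Pr_LP_le w_ge0); [|exact: le_site_refl|exact: endpoint_double].
  by rewrite two; lra.
by rewrite -expRD ler_expR two; nra.
Qed.

(** Midpoint convexity bounds the increment to the right of [r] by half of the
    increment over twice the step, and the increment to the left by the one to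
    the right. *)
Lemma rate_continuous (t r e : R) : - 2^-1 <= t <= 2^-1 -> 0 < r -> 0 < e ->
  exists2 del, 0 < del < r &
    J t (r + del) <= J t r + e /\ J t r - e <= J t (r - del).
Proof.
move=> ht r0 e0.
have step k : J t (r + r / 2 ^+ k) - J t r <= (J t (2 * r) - J t r) / 2 ^+ k.
  elim: k => [|k IHk]; first by rewrite expr0 !divr1 -mulr2n mulr_natl.
  have p0 : 0 < 2 ^+ k :> R by rewrite exprn_gt0.
  have q0 : 0 < r + r / 2 ^+ k by rewrite addr_gt0 // divr_gt0.
  have := rate_midconvex ht r0 q0.
  have -> : (r + (r + r / 2 ^+ k)) / 2 = r + r / 2 ^+ k.+1.
    by rewrite exprS; field; rewrite gt_eqF.
  have -> : (J t (2 * r) - J t r) / 2 ^+ k.+1 = (J t (2 * r) - J t r) / 2 ^+ k / 2.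
    by rewrite exprS; field; rewrite gt_eqF.
  by lra.
pose D := J t (2 * r) - J t r.
have [k kD] : exists k : nat, `|D| / e <= k%:R.
  by exists (Num.bound (`|D| / e)); apply/ltW/archi_boundP; rewrite divr_ge0 // ltW.
have k2 : k%:R <= 2 ^+ k.+1 :> R.
  by rewrite -natrX ler_nat; exact/ltnW/ltnW/ltn_expl.
have p0 : 0 < 2 ^+ k.+1 :> R by rewrite exprn_gt0.
have p1 : 1 < 2 ^+ k.+1 :> R by rewrite exprn_egt1 // ltr1n.
exists (r / 2 ^+ k.+1).
  by rewrite divr_gt0 //= ltr_pdivrMr // ltr_pMr.
have De : D / 2 ^+ k.+1 <= e.
  rewrite ler_pdivrMr //; apply: (le_trans (ler_norm _)).
  by rewrite mulrC -ler_pdivrMr //; exact: le_trans kD k2.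
have up := le_trans (step k.+1) De.
split; first by lra.
have q0 : 0 < r - r / 2 ^+ k.+1 by rewrite subr_gt0 ltr_pdivrMr // ltr_pMr.
have q1 : 0 < r + r / 2 ^+ k.+1 by rewrite addr_gt0 // divr_gt0.
have := rate_midconvex ht q0 q1.
have -> : (r - r / 2 ^+ k.+1 + (r + r / 2 ^+ k.+1)) / 2 = r by field; rewrite gt_eqF.
by lra.
Qed.

End limits.

(** * Lower tail of the diagonal passage time *)

Section lower_tail.
Context {d : measure_display} {T : measurableType d} {R : realType}.
Variables (P : probability T R) (w : int * int -> {RV P >-> R}).
Hypothesis w_ge0 : forall z x, 0 <= w z x.
Hypothesis w_indep : mutually_independent w.
Hypothesis w_id : identically_distributed w.
Local Notation site := (int * int)%type.
Local Notation config := (site -> R).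
Local Notation Pr := (Pr w).
Implicit Types (u v y z : site) (om : config) (r s e : R).

(** A union bound over the set of the events that occur: the combinatorial
    factor is exponential in the number of events, so it is harmless when each
    event is very unlikely. *)
Lemma Pr_many_occur (I : finType) (S : I -> set site) (A : I -> set config)
    (h M : R) : 0 <= h ->
  (forall i j, i != j -> S i `&` S j = set0) ->
  (forall i, depends (S i) (A i)) -> (forall i, Pr (A i) <= expR (- h)) ->
  Pr (\bigcup_(B in [set B : {set I} | M <= #|B|%:R])
        \bigcap_(i in [set` B]) A i) <= 2 ^+ #|I| * expR (- (h * M)).
Proof.
move=> h0 disj dA PA.
pose s := [seq B : {set I} <- enum {set I} | M <= #|B|%:R].
have -> : [set B : {set I} | M <= #|B|%:R] = [set` s].
  by apply/seteqP; split => B; rewrite /= mem_filter mem_enum andbT.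
have dB (B : {set I}) : depends setT (\bigcap_(i in [set` B]) A i).
  by apply: depends_all => i _; exact: depends_mono (dA i).
apply: (le_trans (@Pr_union_bound _ _ _ _ w setT _ s _ (fun B _ => dB B))).
have PB B : B \in s -> Pr (\bigcap_(i in [set` B]) A i) <= expR (- (h * M)).
  rewrite mem_filter => /andP[MB _].
  have -> : [set` B] = [set` enum B].
    by apply/seteqP; split => i; rewrite /= mem_enum.
  rewrite (Pr_bigcap_indep w_indep (enum_uniq _)
    (fun i j _ _ => disj i j) (fun i _ => dA i)).
  apply: (@le_trans _ _ (\prod_(i <- enum B) expR (- h))).
    by apply: ler_prod => i _; rewrite Pr_ge0 PA.
  rewrite big_const_seq count_predT -cardE iter_mulr mulr1 -expRM_natl ler_expR.
  by rewrite mulrN lerN2 [leLHS]mulrC ler_wpM2r.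
apply: (@le_trans _ _ (\sum_(B <- s) expR (- (h * M)))).
  by rewrite big_seq [leRHS]big_seq; exact: ler_sum.
rewrite big_const_seq count_predT iter_addr addr0 -[leLHS]mulr_natl.
apply: ler_wpM2r; first exact: expR_ge0.
rewrite -natrX ler_nat size_filter (leq_trans (count_size _ _)) //.
rewrite -cardE -[#|I|]cardsT -card_powerset; apply: subset_leq_card.
by apply/fintype.subsetP => B _; rewrite powersetE finset.subsetT.
Qed.

Section blocks.
Variables (L K N : nat).

(** Blocks have side [L] and corners on a grid of step [L + 1], so that they
    are disjoint; the corridor [j] consists of the blocks at column [i + j]
    and row [i]. *)
Definition corner (j i : nat) : site :=
  ((L.+1 * (i + j))%:Z, (L.+1 * i)%:Z).

Definition block_end (j i : nat) : site := translate (L%:Z, L%:Z) (corner j i).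

Lemma block_disjoint (p q : 'I_K * 'I_N) : p != q ->
  box (corner p.1 p.2) (block_end p.1 p.2) `&`
  box (corner q.1 q.2) (block_end q.1 q.2) = set0.
Proof.
move=> pq; apply/seteqP; split => // z [[zp1 zp2 _] [zq1 zq2 _]].
move: pq zp1 zp2 zq1 zq2; rewrite /le_site /block_end /translate /corner /=.
case: p q => [j i] [j' i'] /= pq h1 h2 h3 h4.
have ii : (i = i' :> nat).
  by case: (ltngtP i i') => // ii; exfalso; nia.
have jj : (j = j' :> nat).
  by case: (ltngtP j j') => // jj; exfalso; nia.
by case/eqP: pq; congr (_, _); exact: val_inj.
Qed.

(** The good blocks of a corridor are visited in turn; a bad one is crossed
    without counting its weight. *)
Lemma corridor_LP om (a : R) (j n : nat) : nneg om -> 0 <= a ->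
  LP (a * \sum_(i < n) (`[< LP a (corner j i) (block_end j i) om >] : nat)%:R)
    (corner j 0) (corner j n) om.
Proof.
move=> om0 a0; elim: n => [|n IHn].
  by rewrite big_ord0 mulr0; apply: LP0 => //; exact: le_site_refl.
rewrite big_ord_recr /= mulrDr; apply: LP_cat IHn _.
have le1 : le_site (block_end j n) (corner j n.+1).
  by rewrite /le_site /block_end /translate /corner /=; lia.
case: asboolP => [h|_]; rewrite ?mulr1 ?mulr0.
  exact: LP_widen (le_site_refl _) le1 h.
by apply: LP0 => //; rewrite /le_site /corner /=; lia.
Qed.

(** A corridor with fewer bad blocks would collect a weight [s] from its good
    blocks alone. *)
Lemma many_bad_blocks om (a s th : R) n : nneg om -> 0 <= a -> 0 <= th ->
  (L.+1 * (N + K) <= n)%N -> s <= (1 - th) * N%:R * a ->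
  ~ LP s origin (n%:Z, n%:Z) om ->
  exists B : {set 'I_K * 'I_N}, th * (K * N)%:R <= #|B|%:R /\
    forall p, p \in B -> ~ LP a (corner p.1 p.2) (block_end p.1 p.2) om.
Proof.
move=> om0 a0 th0 Nn sa nLP.
pose good j i := `[< LP a (corner j i) (block_end j i) om >].
exists [set p : 'I_K * 'I_N | ~~ good p.1 p.2]%SET; split; last first.
  by move=> p; rewrite inE => /asboolP.
rewrite -sum1_card natr_sum big_mkcond /=.
rewrite (eq_bigr (fun p : 'I_K * 'I_N => (~~ good p.1 p.2 : nat)%:R)); last first.
  by move=> p _; rewrite inE; case: (good _ _).
rewrite -(pair_bigA _ (fun j i => (~~ good (j : 'I_K) (i : 'I_N) : nat)%:R)) /=.
rewrite natrM mulrCA.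
apply: (@le_trans _ _ (\sum_(j < K) (th * N%:R))).
  by rewrite sumr_const card_ord mulr_natl.
apply: ler_sum => j _.
have -> : \sum_(i < N) (~~ good j i : nat)%:R = N%:R - \sum_(i < N) (good j i : nat)%:R :> R.
  rewrite -[N in N%:R]card_ord -sumr_const -sumrB.
  by apply: eq_bigr => i _; case: (good j i); rewrite ?subrr ?subr0.
have [//|lt] := leP (th * N%:R) (N%:R - \sum_(i < N) (good j i : nat)%:R).
exfalso; apply: nLP; apply: LP_mono (LP_widen om0 _ _ (@corridor_LP om a j N om0 a0)).
- apply: (le_trans sa); rewrite mulrC; apply: ler_wpM2l => //.
  rewrite -/(good _ _) in lt *.
  by move: lt; rewrite /good; lra.
- by rewrite /le_site /corner /=; lia.
- by rewrite /le_site /corner /=; have := ltn_ord j; nia.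
Qed.

End blocks.

Variable (mu : R -> R).
Hypothesis mu_shape : is_shape_function w mu.

(** A passage time below its typical value is superexponentially unlikely:
    the number [K] of disjoint corridors may be taken as large as needed. *)
Lemma diag_lower_tail e C : 0 < e -> e < mu 0 -> 0 < C ->
  exists n0, forall n, (n0 <= n)%N ->
    Pr (~` LP ((mu 0 - e) * (2 * n%:R)) origin (n%:Z, n%:Z)) <= expR (- (n%:R * C)).
Proof.
move=> e0 em C0; set m := mu 0 in em *.
have m0 : 0 < m by exact: lt_trans em.
pose th := e / (8 * m); pose h := 2 / th.
have th0 : 0 < th by rewrite divr_gt0 // mulr_gt0.
have thm : th * m = e / 8 by rewrite /th; field; rewrite gt_eqF.
have th1 : th < 1 by rewrite ltr_pdivrMr ?mulr_gt0 //; lra.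
have h0 : 0 < h by rewrite divr_gt0.
have e20 : 0 < e / 2 by rewrite divr_gt0.
have [L0 hL0] := Pr_diag_limit w_ge0 mu_shape e20 (expR_gt0 (- h)).
have [L1 hL1] := nat_above (8 * m / e).
pose L := maxn L0 L1; pose X : R := L%:R.
have eX : 8 * m <= e * X.
  rewrite [leRHS]mulrC -ler_pdivrMr //; apply: (le_trans hL1).
  by rewrite ler_nat leq_maxr.
have badL : Pr (~` LP ((m - e / 2) * (2 * X)) origin (L%:Z, L%:Z)) <= expR (- h).
  by have [] := hL0 L (leq_maxl _ _).
have [K hK] := nat_above (2 * C * (X + 1)).
have [N0 hN0] := nat_above (4 * m * (K%:R + 1) / e + K%:R + 1).
exists (L.+1 * (N0 + K))%N => n n0n.
pose N := (n %/ L.+1 - K)%N.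
have Nn : (N0 + K <= n %/ L.+1)%N by rewrite leq_divRL // mulnC.
have Kn : (K <= n %/ L.+1)%N by exact: leq_trans (leq_addl _ _) Nn.
have KN : (N + K = n %/ L.+1)%N by rewrite subnK.
have NN0 : (N0 <= N)%N by rewrite leq_subRL // addnC.
have n_le : (L.+1 * (N + K) <= n)%N by rewrite KN mulnC leq_trunc_div.
have n_ge : (n <= L.+1 * (N + K + 1))%N.
  by rewrite KN addn1 mulnC ltnW // ltn_ceil.
pose a := (m - e / 2) * (2 * X).
have X0 : 0 <= X by [].
have a0 : 0 <= a by rewrite /a mulr_ge0 //; lra.
have nR : n%:R <= (X + 1) * (N%:R + K%:R + 1) :> R.
  by move: n_ge; rewrite -(ler_nat R) natrM !natrD -natr1.
have N_ge : 4 * m * (K%:R + 1) / e + K%:R + 1 <= N%:R.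
  by apply: le_trans hN0 _; rewrite ler_nat.
have K0 : 0 <= K%:R :> R by [].
have q0 : 0 <= 4 * m * (K%:R + 1) / e.
  by rewrite divr_ge0 ?(ltW e0) // !mulr_ge0 ?(ltW m0) //; lra.
have N1 : K%:R + 1 <= N%:R :> R by lra.
have N2 : 4 * m * (K%:R + 1) <= N%:R * e.
  by rewrite -ler_pdivrMr //; lra.
have sa : (m - e) * (2 * n%:R) <= (1 - th) * N%:R * a.
  have h1 : (m - e) * n%:R <= (m - e) * ((X + 1) * (N%:R + K%:R + 1)).
    by apply: ler_wpM2l => //; lra.
  have h2 : (m - e) * (X + 1) <= (m - 7 / 8 * e) * X by lra.
  have h3 : (m - e) * (X + 1) * (N%:R + K%:R + 1) <=
            (m - 7 / 8 * e) * X * (N%:R + K%:R + 1).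
    by apply: ler_wpM2r => //; lra.
  have eK : 0 <= e * K%:R by rewrite mulr_ge0 // ltW.
  have h4 : (m - 7 / 8 * e) * (N%:R + K%:R + 1) <= (m - 5 / 8 * e) * N%:R by lra.
  have h5 : (m - 7 / 8 * e) * (N%:R + K%:R + 1) * X <= (m - 5 / 8 * e) * N%:R * X.
    exact: ler_wpM2r.
  have the : 0 <= th * e by rewrite mulr_ge0 // ltW.
  have h6 : m - 5 / 8 * e <= (1 - th) * (m - e / 2) by lra.
  have h7 : (m - 5 / 8 * e) * (N%:R * X) <= (1 - th) * (m - e / 2) * (N%:R * X).
    by apply: ler_wpM2r => //; exact: mulr_ge0.
  by rewrite /a; lra.
have step : Pr (~` LP ((m - e) * (2 * n%:R)) origin (n%:Z, n%:Z)) <=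
    2 ^+ #|{: 'I_K * 'I_N}| * expR (- (h * (th * (K * N)%:R))).
  pose S (p : 'I_K * 'I_N) := box (corner L p.1 p.2) (block_end L p.1 p.2).
  pose A (p : 'I_K * 'I_N) := ~` LP a (corner L p.1 p.2) (block_end L p.1 p.2).
  have dA p : depends (S p) (A p) by apply: dependsC; exact: depends_LP.
  have PA p : Pr (A p) <= expR (- h).
    rewrite /A (@Pr_setC _ _ _ _ w setT) ?/block_end; last exact: depends_LPT.
    have {1}-> : corner L p.1 p.2 = translate (corner L p.1 p.2) origin.
      by rewrite /translate /= !add0r.
    rewrite (_ : translate (L%:Z, L%:Z) _ = translate (corner L p.1 p.2) (L%:Z, L%:Z));
      last by rewrite /translate /=; congr (_, _); rewrite addrC.
    rewrite Pr_LP_translate // -(@Pr_setC _ _ _ _ w setT) //.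
    exact: depends_LPT.
  apply: le_trans (Pr_many_occur _ (ltW h0) (@block_disjoint L K N) dA PA).
  apply: (Pr_le w_ge0 (S := setT)).
  - by apply: dependsC; exact: depends_LPT.
  - apply: depends_ex => B _; apply: depends_all => p _.
    exact: depends_mono (dA p).
  - move=> om om0 nLP.
    have [B [BM BA]] := many_bad_blocks om0 a0 (ltW th0) n_le sa nLP.
    by exists B => //= p pB; exact: BA.
apply: (le_trans step); rewrite card_prod !card_ord.
have -> : h * (th * (K * N)%:R) = 2 * (K * N)%:R by rewrite /h; field; rewrite gt_eqF.
apply: (@le_trans _ _ (expR (K * N)%:R * expR (- (2 * (K * N)%:R)))).
  apply: ler_wpM2r; first exact: expR_ge0.
  rewrite -[X in expR X]mulr1 expRM_natl; apply: lerXn2r; rewrite ?nnegrE ?expR_ge0 //.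
  by apply: le_trans (expR_ge1Dx 1); lra.
rewrite -expRD ler_expR natrM.
have c1 : C * n%:R <= C * ((X + 1) * (N%:R + K%:R + 1)) by rewrite ler_pM2l.
have c2 : 2 * C * (X + 1) * (N%:R + K%:R + 1) <= K%:R * (N%:R + K%:R + 1).
  by apply: ler_wpM2r => //; lra.
have c3 : K%:R * (N%:R + K%:R + 1) <= K%:R * (2 * N%:R) :> R.
  by apply: ler_wpM2l => //; lra.
lra.
Qed.

End lower_tail.

(** * The midpoint and the reflection principle *)

(** A path changes the difference of the coordinates by one at each step, so
    it cannot jump over a diagonal line. *)
Lemma upath_diff_ex (u v : int * int) p (D : int) : up_right_path u v p ->
  u.1 - u.2 <= D <= v.1 - v.2 -> exists2 y : int * int, y \in u :: p & y.1 - y.2 = D.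
Proof.
elim: p u => [|x p IHp] u.
  rewrite upath_nil => /eqP <- /andP[u1 u2]; exists u; rewrite ?mem_head //; lia.
rewrite upath_cons => /andP[ux pp] /andP[uD Dv].
have [uD'|uD'] := eqVneq (u.1 - u.2) D; first by exists u; rewrite ?mem_head.
have [|y yp yD] := IHp _ pp; last by exists y => //; rewrite inE yp orbT.
by move: ux uD uD' => /orP[] /eqP -> /=; lia.
Qed.

Section midpoint.
Context {R : realType}.
Local Notation site := (int * int)%type.
Local Notation config := (site -> R).
Implicit Types (u v y z : site) (om : config) (r s e : R).

Lemma is_geodesic_geodesic om u v : le_site u v ->
  is_geodesic om u v (geodesic om u v).
Proof.
move=> /(LP_max om)[p pp pmax].
rewrite /geodesic; apply: (@xgetPex _ [::] [set p | is_geodesic om u v p]).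
by exists p; apply/geodesicP.
Qed.

Lemma midP om (n : nat) : let g := geodesic om origin (n%:Z, n%:Z) in
  mid om n \in origin :: g /\ level (mid om n) = n.
Proof.
have /(is_geodesic_geodesic om)/geodesicP[gp _] : le_site origin (n%:Z, n%:Z).
  by rewrite /le_site /=; lia.
have [z zg zn] : exists2 z, z \in origin :: geodesic om origin (n%:Z, n%:Z) &
    level z = n.
  by apply: upath_level_ex gp _; rewrite /level /=; lia.
exact: (@xgetPex _ origin [set z | z \in origin :: geodesic om origin (n%:Z, n%:Z) /\
  z.1 + z.2 = n%:Z] (ex_intro _ z (conj zg zn))).
Qed.

Lemma depends_weight_le (p q : seq site) :
  depends setT [set om : config | path_weight om q <= path_weight om p].
Proof.
rewrite (_ : [set om | _] = ~` \bigcup_(c : rat)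
    (~` [set om | ratr c <= path_weight om p] `&`
     [set om | ratr c <= path_weight om q])).
  apply: dependsC; apply: depends_ex => c _; apply: dependsI.
    by apply: dependsC; exact: depends_sum.
  exact: depends_sum.
apply/seteqP; split=> om /=.
  by move=> qp [c _ [/= h1 h2]]; apply: h1; exact: le_trans qp.
move=> h; rewrite leNgt; apply/negP => pq; apply: h.
have [c] := rat_in_itvoo pq; rewrite in_itv /= => /andP[c1 c2].
by exists c => //; split => /=; [apply/negP; rewrite -ltNge|exact: ltW].
Qed.

Lemma depends_geodesic u v p : depends setT [set om : config | is_geodesic om u v p].
Proof.
rewrite (_ : [set om | _] = [set om | up_right_path u v p] `&`
  \bigcap_(q in [set q | up_right_path u v q])
    [set om | path_weight om q <= path_weight om p]); last first.
  by apply/seteqP; split => om /= /geodesicP.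
apply: dependsI; last by apply: depends_all => q _; exact: depends_weight_le.
case: (up_right_path u v p).
  rewrite (_ : [set om | _] = setT); [exact: dependsT|exact/seteqP].
rewrite (_ : [set om | _] = ~` setT).
  by apply: dependsC; exact: dependsT.
by rewrite setCT; apply/seteqP; split.
Qed.

(** The midpoint is a function of the finite family of booleans that tell
    which paths are geodesics. *)
Lemma depends_mid n (Q : set site) : depends setT [set om : config | Q (mid om n)].
Proof.
set v : site := (n%:Z, n%:Z).
pose s := upaths origin `|level v - level origin|%N.
pose code om := [seq `[< is_geodesic om origin v p >] | p <- s].
have code_mid om1 om2 : code om1 = code om2 -> mid om1 n = mid om2 n.
  move=> /eq_in_map c12; rewrite /mid /geodesic.
  suff -> : [set p | is_geodesic om1 origin v p] = [set p | is_geodesic om2 origin v p].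
    by [].
  have geoE om p : is_geodesic om origin v p <-> p \in s /\ `[< is_geodesic om origin v p >].
    split=> [gp|[_ /asboolP]//]; split; last exact/asboolP.
    by case: gp => /upaths_mem.
  by apply/seteqP; split => p /= /geoE[ps]; rewrite (c12, =^~ c12) // => gp; apply/geoE; split.
have dcode b : depends setT [set om | code om = b].
  rewrite /code; elim: (s) b => [|p s' IHs] [|c b] /=.
  - rewrite (_ : [set om | _] = setT); first exact: dependsT.
    by apply/seteqP; split.
  - rewrite (_ : [set om | _] = ~` setT); first by apply: dependsC; exact: dependsT.
    by rewrite setCT; apply/seteqP; split.
  - rewrite (_ : [set om | _] = ~` setT); first by apply: dependsC; exact: dependsT.
    by rewrite setCT; apply/seteqP; split.
  rewrite (_ : [set om | _] = [set om | `[< is_geodesic om origin v p >] = c] `&`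
    [set om | [seq `[< is_geodesic om origin v p >] | p <- s'] = b]); last first.
    by apply/seteqP; split => om /= [-> ->].
  apply: dependsI (IHs b); case: c.
    rewrite (_ : [set om | _] = [set om | is_geodesic om origin v p]).
      exact: depends_geodesic.
    by apply/seteqP; split => om /asboolP.
  rewrite (_ : [set om | _] = ~` [set om | is_geodesic om origin v p]).
    by apply: dependsC; exact: depends_geodesic.
  by apply/seteqP; split => om /=; [move/negbT/asboolPn|move/asboolPn/negbTE].
rewrite (_ : [set om | _] = \bigcup_(b in [set b | exists2 om', code om' = b & Q (mid om' n)])
  [set om | code om = b]).
  by apply: depends_ex => b _; exact: dcode.
apply/seteqP; split=> om /=.
  by move=> Qm; exists (code om) => //; exists om.
by move=> [b [om' <- Q'] /code_mid ->].
Qed.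

End midpoint.

Section upper_bound.
Context {d : measure_display} {T : measurableType d} {R : realType}.
Variables (P : probability T R) (w : int * int -> {RV P >-> R}).
Hypothesis w_ge0 : forall z x, 0 <= w z x.
Hypothesis w_indep : mutually_independent w.
Hypothesis w_id : identically_distributed w.
Local Notation site := (int * int)%type.
Local Notation config := (site -> R).
Local Notation Pr := (Pr w).
Implicit Types (u v y z : site) (om : config) (r s e : R).

(** A geodesic with midpoint to the right of [a] crosses the diagonal line
    that contains [(a, n - a)]; transposing it from there on leads to
    [(2 * a, 2 * (n - a))]. *)
Lemma Pr_mid_ge (n : nat) (a : int) s : n%:Z <= 2 * a ->
  Pr [set om | a <= (mid om n).1] <=
  Pr (~` LP s origin (n%:Z, n%:Z)) +
  n.+1%:R * Pr (LP s origin (2 * a, 2 * (n%:Z - a))).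
Proof.
move=> na; pose D := 2 * a - n%:Z.
pose H (j : nat) : set config := passes_through s origin (D + j%:Z, j%:Z) (n%:Z, n%:Z).
have dH j : depends setT (H j) by exact: depends_passes.
have PH j : Pr (H j) <= Pr (LP s origin (2 * a, 2 * (n%:Z - a))).
  apply: le_trans (Pr_passes_reflect w_ge0 w_indep w_id _ _ _) _.
  rewrite le_eqVlt; apply/orP; left; apply/eqP; rewrite /D /=.
  by congr (Pr (LP _ _ (_, _))); lia.
apply: (@le_trans _ _ (Pr (~` LP s origin (n%:Z, n%:Z) `|`
    \bigcup_(j in [set` iota 0 n.+1]) H j))).
  apply: (Pr_le w_ge0 (S := setT)).
  - exact: (@depends_mid _ n [set z | a <= z.1]).
  - apply: dependsU; first by apply: dependsC; exact: depends_LPT.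
    by apply: depends_ex => j _; exact: dH.
  move=> om om0 /= am; have [LPs|] := pselect (LP s origin (n%:Z, n%:Z) om); last by left.
  right; have [zg zn] := midP om n; set z := mid om n in am zg zn.
  have /(is_geodesic_geodesic om)/geodesicP[gp gmax] : le_site origin (n%:Z, n%:Z).
    by rewrite /le_site /=; lia.
  set g := geodesic _ _ _ in zg gp gmax.
  have [g1 [g2 [gE g1p g2p]]] := upath_split gp zg.
  have [|y yg yD] := upath_diff_ex g1p (D := D).
    by move: am zn na; rewrite /level /D /=; lia.
  have yg' : y \in origin :: g.
    by move: yg; rewrite gE !inE mem_cat => /orP[->//|->]; rewrite orbT.
  have [p1 [p2 [pE p1p p2p]]] := upath_split gp yg'.
  have := upath_le p1p; have := upath_le p2p; rewrite /le_site /= => y1 y2.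
  have jn : `|y.2|%N \in iota 0 n.+1 by rewrite mem_iota; lia.
  exists `|y.2|%N; first exact: jn.
  have yE : (D + `|y.2|%N%:Z, `|y.2|%N%:Z) = y.
    by rewrite [RHS]surjective_pairing; congr (_, _); lia.
  rewrite /H yE; exists p1, p2; split => //.
  have [q qp sq] := LPs; apply: (le_trans sq); apply: (le_trans (gmax q qp)).
  by rewrite pE path_weight_cat.
apply: le_trans (@Pr_setU _ _ _ _ w setT _ _ _ _) _.
- by apply: dependsC; exact: depends_LPT.
- by apply: depends_ex => j _; exact: dH.
rewrite lerD2l; apply: le_trans (@Pr_union_bound _ _ _ _ w setT _ _ _ (fun j _ => dH j)) _.
apply: le_trans (ler_sum _ (fun j _ => PH j)) _.
by rewrite big_const_seq count_predT size_iota iter_addr addr0 [leRHS]mulr_natl.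
Qed.

End upper_bound.

(** * Exponential tails of passage times *)

Lemma upath_uniq (u v : int * int) p : up_right_path u v p -> uniq p.
Proof.
elim: p u => //= x p IHp u; rewrite upath_cons => /andP[_ pp].
rewrite (IHp _ pp) andbT; apply/negP => xp.
by have [_ _] := upath_mem pp xp; rewrite ltxx.
Qed.

Lemma sum_geometric_le {R : realType} (q : R) n : 0 <= q -> q < 1 ->
  \sum_(0 <= j < n) q ^+ j <= (1 - q)^-1.
Proof.
move=> q0 q1; rewrite -[leRHS]mul1r ler_pdivlMr ?subr_gt0 //.
have -> : (\sum_(0 <= j < n) q ^+ j) * (1 - q) = 1 - q ^+ n.
  elim: n => [|n IHn]; first by rewrite big_nil mul0r expr0 subrr.
  by rewrite big_nat_recr //= mulrDl IHn exprS; lra.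
by rewrite gerBl exprn_ge0.
Qed.

Section exponential_moment.
Context {d : measure_display} {T : measurableType d} {R : realType}.
Variables (P : probability T R) (w : int * int -> {RV P >-> R}).
Hypothesis w_ge0 : forall z x, 0 <= w z x.
Hypothesis w_indep : mutually_independent w.
Hypothesis w_id : identically_distributed w.
Hypothesis w_exp : exists2 alpha : R, 0 < alpha &
  forall z, ('M_P (w z) alpha < +oo)%E.
Local Notation site := (int * int)%type.
Local Notation config := (site -> R).
Local Notation Pr := (Pr w).
Implicit Types (u v z : site) (om : config) (r s : R).

(** Markov's inequality for the exponential moment. *)
Lemma weight_tail : exists alpha M, [/\ 0 < alpha, 1 <= M &
  forall z s, Pr [set om | s <= om z] <= M * expR (- (alpha * s))].
Proof.
have [alpha a0 mgf] := w_exp.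
have mc z s : depends setT [set om : config | s <= om z].
  rewrite (_ : [set om | _] = [set om | `[s, +oo[%classic (om z)]).
    exact: depends_coord.
  by apply/seteqP; split => om; rewrite /= in_itv /= andbT.
have m0 : (0 <= 'M_P (w origin) alpha)%E.
  by rewrite /mmt_gen_fun expectation_ge0 // => x; rewrite expR_ge0.
have mfin : 'M_P (w origin) alpha \is a fin_num by rewrite ge0_fin_numE.
exists alpha, (1 + fine ('M_P (w origin) alpha)); split => //.
  by rewrite lerDl fine_ge0.
move=> z s.
have -> : Pr [set om | s <= om z] = Pr [set om | s <= om origin].
  have := Pr_coord w_id z origin (measurable_itv `[s, +oo[).
  by rewrite /mkset; under eq_fun do rewrite in_itv /= andbT;
    under [X in _ = Pr X -> _]eq_fun do rewrite in_itv /= andbT.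
apply: (@le_trans _ _ (fine ('M_P (w origin) alpha) * expR (- (alpha * s)))).
  rewrite -lee_fin EFinM (fineK mfin) -(PrE w (mc origin s)).
  exact: (chernoff (w origin) s a0).
by rewrite ler_pM2r ?expR_gt0 // lerDr.
Qed.

(** By induction on the number of summands. Splitting according to the integer
    part of the first weight costs a geometric series, which converges because
    [beta] is only half of the exponent of a single weight; its sum is the
    prefactor [A] per summand. *)
Lemma sum_tail : exists A beta, [/\ 1 <= A, 0 < beta &
  forall (p : seq site) s, uniq p ->
    Pr [set om | s <= path_weight om p] <= A ^+ size p * expR (- (beta * s))].
Proof.
have [alpha [M [a0 M1 tail]]] := weight_tail.
pose beta := alpha / 2; have b0 : 0 < beta by rewrite divr_gt0.
have aE : alpha = beta + beta by rewrite /beta -splitr.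
pose q := expR (- beta).
have q0 : 0 <= q by exact: expR_ge0.
have q1 : q < 1 by rewrite -expR0 ltr_expR oppr_lt0.
pose G := (1 - q)^-1; have G0 : 0 <= G by rewrite invr_ge0 subr_ge0 ltW.
pose A := M * expR beta * G + M.
have M0 : 0 <= M by exact: le_trans M1.
have MG0 : 0 <= M * expR beta * G by rewrite !mulr_ge0 // expR_ge0.
have A1 : 1 <= A by rewrite /A; lra.
exists A, beta; split => //.
have mS p s : depends setT [set om : config | s <= path_weight om p] by exact: depends_sum.
elim=> [|z p IHp] s.
  move=> _; rewrite expr0 mul1r; have [s0|s0] := leP s 0.
    apply: (le_trans (Pr_le1 w_ge0 (mS _ _))).
    by rewrite -expR0 ler_expR oppr_ge0 pmulr_rle0.
  rewrite (_ : [set om | _] = set0) ?Pr_set0 ?expR_ge0 //.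
  by apply/seteqP; split => // om; rewrite /= /path_weight big_nil leNgt s0.
move=> /= /andP[zp up]; set k := size p.
have Ak1 n : 1 <= A ^+ n by exact: exprn_ege1.
have [s0|s0] := leP s 0.
  apply: (le_trans (Pr_le1 w_ge0 (mS _ _))); rewrite -[leLHS]mul1r.
  by apply: ler_pM => //; rewrite -expR0 ler_expR oppr_ge0 pmulr_rle0.
have [n sn] := nat_above s.
have mz (j : R) : depends [set z] [set om : config | j <= om z].
  rewrite (_ : [set om | _] = [set om | `[j, +oo[%classic (om z)]).
    exact: depends_coord.
  by apply/seteqP; split => om; rewrite /= in_itv /= andbT.
have mzT (j : R) := depends_mono (@subsetT _ [set z]) (mz j).
(* Here [j] is the integer part of the weight at [z]. *)
pose H (j : nat) : set config :=
  [set om | j%:R <= om z] `&` [set om | s - j%:R - 1 <= path_weight om p].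
have mH j : depends setT (H j) by apply: dependsI; [exact: mzT|exact: mS].
have PH j : Pr (H j) <= M * expR beta * A ^+ k * expR (- (beta * s)) * q ^+ j.
  rewrite (@Pr_indep _ _ _ _ _ w_indep [set z] [set` p]); last 3 first.
  - by apply/seteqP; split => // y [/= ->]; rewrite (negbTE zp).
  - exact: mz.
  - exact: depends_sum.
  apply: (le_trans (ler_pM (Pr_ge0 _ _) (Pr_ge0 _ _) (tail _ _) (IHp _ up))).
  rewrite /q -expRM_natl mulrACA -expRD.
  rewrite [leRHS](_ : _ = M * A ^+ k *
    (expR beta * expR (- (beta * s)) * expR (j%:R * - beta))); last by ring.
  rewrite -!expRD.
  apply: ler_wpM2l; first by rewrite mulr_ge0 // exprn_ge0 // (le_trans ler01).
  by rewrite ler_expR aE; lra.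
apply: (@le_trans _ _ (Pr ((\bigcup_(j in [set` iota 0 n]) H j) `|`
    [set om | n%:R <= om z]))).
  apply: (Pr_le w_ge0 (S := setT)); first exact: mS.
    by apply: dependsU => //; apply: depends_ex => j _; exact: mH.
  move=> om om0 /=; rewrite /path_weight big_cons -/(path_weight om p) => sW.
  have [nz|zn] := leP n%:R (om z); [by right|left].
  have /andP[t1 t2] := truncn_itv (om0 z).
  set j := Num.truncn (om z) in t1 t2.
  have jn : j \in iota 0 n.
    by rewrite mem_iota /= add0n -(ltr_nat R); exact: le_lt_trans zn.
  by exists j; [exact: jn|split => //=; move: t2; rewrite -natr1; lra].
apply: le_trans (@Pr_setU _ _ _ _ w setT _ _ _ _) _ => //.
  by apply: depends_ex => j _; exact: mH.
rewrite exprS -/k {1}/A mulrDl mulrDl; apply: lerD.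
  apply: le_trans (@Pr_union_bound _ _ _ _ w setT _ _ _ (fun j _ => mH j)) _.
  apply: le_trans (ler_sum _ (fun j _ => PH j)) _.
  rewrite -mulr_sumr.
  rewrite (_ : M * _ * G * _ * _ =
    M * expR beta * A ^+ k * expR (- (beta * s)) * G); last by lra.
  apply: ler_wpM2l.
    by rewrite !mulr_ge0 ?expR_ge0 // exprn_ge0 // (le_trans ler01).
  have := sum_geometric_le n q0 q1.
  by rewrite /index_iota subn0.
apply: (le_trans (tail _ _)); rewrite -mulrA; apply: ler_wpM2l => //.
rewrite -[leLHS]mul1r; apply: ler_pM => //.
rewrite ler_expR lerN2 aE mulrDl.
have h1 : beta * s <= beta * n%:R by rewrite ler_pM2l.
have h2 : 0 <= beta * s by rewrite mulr_ge0 // ltW.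
by lra.
Qed.

(** Union bound over the [2 ^ k] paths with [k] steps. *)
Lemma LP_tail : exists A beta, [/\ 1 <= A, 0 < beta &
  forall u v (k : nat) s, level v - level u = k ->
    Pr (LP s u v) <= (2 * A) ^+ k * expR (- (beta * s))].
Proof.
have [A [beta [A1 b0 tail]]] := sum_tail.
exists A, beta; split => // u v k s kE.
pose ps := [seq p <- upaths u k | up_right_path u v p].
have mS p : depends setT [set om : config | s <= path_weight om p] by exact: depends_sum.
apply: (@le_trans _ _ (Pr (\bigcup_(p in [set` ps]) [set om | s <= path_weight om p]))).
  apply: (Pr_le w_ge0 (@depends_LPT _ _ _ _)); first exact: depends_ex.
  move=> om _ [p pp sp]; exists p => //=.
  by rewrite mem_filter pp /= -[k]/(`|k%:Z|%N) -kE upaths_mem.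
apply: le_trans (@Pr_union_bound _ _ _ _ w setT _ _ _ (fun p _ => mS p)) _.
apply: (@le_trans _ _ (\sum_(p <- ps) A ^+ k * expR (- (beta * s)))).
  rewrite big_seq [leRHS]big_seq; apply: ler_sum => p.
  rewrite mem_filter upathsP => /andP[pp /andP[_ /eqP <-]].
  exact: tail (upath_uniq pp).
rewrite big_const_seq count_predT iter_addr addr0 -[leLHS]mulr_natl exprMn -mulrA.
apply: ler_wpM2r; first by rewrite mulr_ge0 ?expR_ge0 // exprn_ge0 // (le_trans ler01).
by rewrite -natrX ler_nat size_filter -(size_upaths u k) count_size.
Qed.

End exponential_moment.

(** * The upper bound *)

(** Polynomial and constant factors do not change an exponential rate. *)
Lemma poly_le_exp {R : realType} (e D : R) : 0 < e ->
  exists N, forall n, (N <= n)%N -> (n%:R + 2) * expR D <= expR (n%:R * e).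
Proof.
move=> e0; have [N hN] := nat_above ((2 / e + 2) * expR D * (2 / e)).
exists N => n Nn; set y := expR (n%:R * (e / 2)).
have -> : expR (n%:R * e) = y * y by rewrite -expRD; congr expR; lra.
have y0 : 0 < y by exact: expR_gt0.
have x0 : 0 <= n%:R * (e / 2) by rewrite mulr_ge0 // ltW // divr_gt0.
have y1 : 1 + n%:R * (e / 2) <= y by exact: expR_ge1Dx.
have e2 : 0 < 2 / e by rewrite divr_gt0.
have nE : n%:R = (2 / e) * (n%:R * (e / 2)) by field; rewrite gt_eqF.
have h1 : n%:R + 2 <= (2 / e + 2) * y.
  have q : 2 / e * (n%:R * (e / 2)) <= 2 / e * y by rewrite ler_pM2l //; lra.
  by rewrite -nE in q; rewrite mulrDl; apply: lerD => //; lra.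
have h2 : (2 / e + 2) * expR D <= y.
  apply: (@le_trans _ _ (n%:R * (e / 2))); last by lra.
  have := le_trans hN (_ : N%:R <= n%:R); rewrite ler_nat => /(_ Nn).
  rewrite -ler_pdivlMr // invf_div.
  by apply.
apply: (@le_trans _ _ ((2 / e + 2) * y * expR D)).
  by apply: ler_wpM2r => //; exact: expR_ge0.
by rewrite mulrAC ler_pM2r.
Qed.

Section upper_bound_rate.
Context {d : measure_display} {T : measurableType d} {R : realType}.
Variables (P : probability T R) (w : int * int -> {RV P >-> R}).
Hypothesis w_ge0 : forall z x, 0 <= w z x.
Hypothesis w_indep : mutually_independent w.
Hypothesis w_id : identically_distributed w.
Variable (mu : R -> R).
Hypothesis mu_shape : is_shape_function w mu.
Variable (J : R -> R -> R).
Hypothesis J_rate : is_upper_tail_rate w J.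
Local Notation Pr := (Pr w).
Implicit Types (e eps t : R).

(** The reflected midpoint is dominated by the endpoint in direction [t] at a
    slightly larger distance. The margin [C] absorbs the rounding; for
    [t = 1/2] the second coordinate vanishes and no rounding occurs. *)
Lemma endpoint_margin t : 0 < t -> t <= 2^-1 -> exists C : nat, forall n : nat,
  let a := Num.floor (n%:R / 2 + t * n%:R) in
  le_site (2 * a, 2 * (n%:Z - a)) (endpoint t (2 * n + C)%N).
Proof.
move=> t0 t2.
have [C hC] : exists C : nat, t = 2^-1 \/ 2 <= (2^-1 - t) * C%:R.
  have [->|tlt] := eqVneq t 2^-1; first by exists 0%N; left.
  have c0 : 0 < 2^-1 - t by rewrite subr_gt0 lt_neqAle tlt.
  have [C hC] := nat_above (2 / (2^-1 - t)).
  by exists C; right; rewrite mulrC -ler_pdivrMr.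
exists C => n /=; set a := Num.floor _; rewrite /le_site /endpoint /= !floor_ge_int !intrM intrB natrD natrM.
have a1 : a%:~R <= n%:R / 2 + t * n%:R :> R by exact: floor_le.
have a2 : n%:R / 2 + t * n%:R < a%:~R + 1 :> R.
  by have /andP[_] := floor_itv (n%:R / 2 + t * n%:R); rewrite intrD.
have tC : 0 <= t * C%:R by rewrite mulr_ge0 // ltW.
have C0 : 0 <= C%:R :> R by [].
apply/andP; split; first by lra.
have [tE|t2C] := hC; last by rewrite -!pmulrn; lra.
have aE : a = n%:Z.
  by rewrite /a tE [2^-1 * _]mulrC -splitr -[_%:R]/((n%:Z)%:~R) intrKfloor.
by rewrite aE subrr mulr0 tE; lra.
Qed.

Lemma le_double_floor t (n : nat) : 0 <= t -> ~~ odd n ->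
  n%:Z <= 2 * Num.floor (n%:R / 2 + t * n%:R).
Proof.
move=> t0 evn; set a := Num.floor _.
have [k nk] : exists k, n = k.*2.
  by exists n./2; rewrite -[LHS]odd_double_half (negbTE evn).
suff ka : k%:Z <= a by rewrite nk; lia.
rewrite /a floor_ge_int nk -muln2 natrM mulfK ?pnatr_eq0 //.
by rewrite -pmulrn lerDl !mulr_ge0.
Qed.

Lemma mid_ge_upper t eps : 0 < t -> t <= 2^-1 -> 0 < mu 0 -> 0 < eps ->
  exists n0, forall n, (n0 <= n)%N -> ~~ odd n ->
    Pr [set om | Num.floor (n%:R / 2 + t * n%:R) <= (mid om n).1] <=
    expR (- 2 * n%:R * (J t (mu 0) - eps)).
Proof.
move=> t0 t2 mu0 eps0.
have ht : - 2^-1 <= t <= 2^-1 by apply/andP; split; lra.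
have eps4 : 0 < eps / 4 by rewrite divr_gt0.
have [del /andP[del0 delmu] [_ Jdel]] :=
  rate_continuous w_ge0 w_indep w_id J_rate ht mu0 eps4.
have r0 : 0 < mu 0 - del by rewrite subr_gt0.
have [N1 hN1] := rate_LP J_rate ht r0 eps4.
set J0 := J t (mu 0) in Jdel *; set J1 := J t (mu 0 - del) in Jdel hN1.
have del2 : 0 < del / 2 by rewrite divr_gt0.
have delm : del / 2 < mu 0 by lra.
have rate0 : 0 < 2 * `|J0| + 1 by rewrite ltr_wpDl // mulr_ge0.
have [N2 hN2] := diag_lower_tail w_ge0 w_indep w_id mu_shape del2 delm rate0.
have [C hC] := endpoint_margin t0 t2.
pose D := C%:R * (`|J0| + eps).
have [N3 hN3] := poly_le_exp D eps0.
have [N4 hN4] := nat_above ((mu 0 - del) * C%:R / del).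
exists (maxn (maxn N1 N2) (maxn N3 N4)) => n; rewrite !geq_max.
move=> /andP[/andP[n1' n2] /andP[n3 n4]] evn.
have n1 : (N1 <= 2 * n + C)%N.
  exact: leq_trans n1' (leq_trans (leq_pmull n (isT : (0 < 2)%N)) (leq_addr _ _)).
set a := Num.floor _.
have na : n%:Z <= 2 * a.
  exact: le_double_floor (ltW t0) evn.
apply: (le_trans (Pr_mid_ge w_ge0 w_indep w_id ((mu 0 - del / 2) * (2 * n%:R)) na)).
have nR : 0 <= n%:R :> R by [].
have p1 : Pr (~` LP ((mu 0 - del / 2) * (2 * n%:R)) origin (n%:Z, n%:Z)) <=
    expR (D - 2 * n%:R * (J0 - eps / 2)).
  apply: (le_trans (hN2 n n2)); rewrite ler_expR.
  have := ler_norm J0; have D0 : 0 <= D by rewrite mulr_ge0 // addr_ge0 // ltW.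
  have q1 : 0 <= n%:R * (`|J0| - J0) by rewrite mulr_ge0 // subr_ge0 ler_norm.
  have q2 : 0 <= n%:R * eps by rewrite mulr_ge0 // ltW.
  by lra.
have p2 : Pr (LP ((mu 0 - del / 2) * (2 * n%:R)) origin (2 * a, 2 * (n%:Z - a))) <=
    expR (D - 2 * n%:R * (J0 - eps / 2)).
  have /andP[_ hi] := hN1 _ n1.
  apply: (@le_trans _ _ (expR (- ((2 * n + C)%N%:R * (J1 - eps / 4))))).
    apply: le_trans hi; apply: (Pr_LP_le w_ge0) => //; last exact: hC.
    have : (mu 0 - del) * C%:R / del <= n%:R by apply: (le_trans hN4); rewrite ler_nat.
    by rewrite ler_pdivrMr // natrD natrM; lra.
  rewrite ler_expR natrD natrM.
  have q1 : (2 * n%:R + C%:R) * (J0 - eps / 2) <= (2 * n%:R + C%:R) * (J1 - eps / 4).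
    by apply: ler_wpM2l; [rewrite addr_ge0 // mulr_ge0|lra].
  have q2 : 0 <= C%:R * (J0 + `|J0| + eps / 2).
    have := ler_norm (- J0); rewrite normrN => q3.
    by rewrite mulr_ge0 //; lra.
  by rewrite /D; lra.
apply: (@le_trans _ _ ((n%:R + 2) * expR (D - 2 * n%:R * (J0 - eps / 2)))).
  rewrite (_ : n%:R + 2 = 1 + n.+1%:R); last by rewrite -natr1; lra.
  by rewrite [leRHS]mulrDl mul1r; apply: lerD => //; exact: ler_wpM2l.
rewrite expRD mulrA.
apply: (@le_trans _ _ (expR (n%:R * eps) * expR (- (2 * n%:R * (J0 - eps / 2))))).
  by apply: ler_wpM2r; [exact: expR_ge0|exact: hN3].
by rewrite -expRD ler_expR; lra.
Qed.

End upper_bound_rate.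

(** * A detour through a fast corridor *)

Section last_and_first_visit.
Local Notation site := (int * int)%type.
Implicit Types (u v y z : site) (p : seq site) (C : set site).

Lemma upath_last_visit C u v p : up_right_path u v p ->
  (exists2 x, x \in u :: p & C x) ->
  exists x p1 p2, [/\ p = p1 ++ p2, up_right_path u x p1, up_right_path x v p2,
    C x & forall y, y \in p2 -> ~ C y].
Proof.
elim: p u => [|x p IHp] u pp [y yp Cy].
  exists u, [::], [::]; split => //; first by rewrite upath_nil.
  by move: yp; rewrite inE => /eqP <-.
have [hp|hp] := pselect (exists2 x', x' \in x :: p & C x').
  move: (pp); rewrite upath_cons => /andP[ux pp'].
  have [x' [p1 [p2 [-> p1p p2p Cx' nC]]]] := IHp _ pp' hp.
  by exists x', (x :: p1), p2; split; rewrite // upath_cons ux.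
exists u, [::], (x :: p); split => //.
- by rewrite upath_nil.
- move: yp; rewrite inE => /predU1P[<- //|yp].
  by case: hp; exists y.
- by move=> y' y'p Cy'; apply: hp; exists y'.
Qed.

Lemma upath_first_visit C u v p : up_right_path u v p ->
  (exists2 x, x \in p & C x) ->
  exists x p1 p2, [/\ p = p1 ++ x :: p2, up_right_path u x (p1 ++ [:: x]),
    up_right_path x v p2, C x & forall y, y \in p1 -> ~ C y].
Proof.
elim: p u => [|x p IHp] u; first by move=> _ [].
rewrite upath_cons => /andP[ux pp] [y yp Cy].
have [Cx|nCx] := pselect (C x).
  by exists x, [::], p; split => //; rewrite upath_cons ux upath_nil eqxx.
have [|x' [p1 [p2 [-> p1p p2p Cx' nC]]]] := IHp _ pp.
  by move: yp; rewrite inE => /predU1P[yx|yp]; [rewrite yx in Cy|exists y].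
exists x', (x :: p1), p2; split => //; first by rewrite cat_cons upath_cons ux.
by move=> y'; rewrite inE => /predU1P[->//|]; exact: nC.
Qed.

End last_and_first_visit.

Section detour.
Context {R : realType}.
Local Notation site := (int * int)%type.
Local Notation config := (site -> R).
Implicit Types (u v x y : site) (om : config).

Variables (n q : nat) (alpha beta : nat -> site) (z : site) (s1 s2 : seq site).
Variables (L : nat) (r K : R).

(** The sites [alpha i] and [beta i] are the corners of the blocks before and
    after the middle part, numbered from the middle; [s1] and [s2] are the two
    halves of the path through the middle part, which meet at [z]. *)
Definition corridor : set site := [set y |
  [\/ exists2 i, (i < q)%N & le_site (alpha i.+1) y && le_site y (alpha i),
      y \in alpha 0%N :: s1 ++ s2 |
      exists2 i, (i < q)%N & le_site (beta i) y && le_site y (beta i.+1)]].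

(** Erasing the weights of the corridor turns statements about bypasses into
    events that do not depend on the corridor. *)
Definition off_corridor om : config := fun y => if `[< corridor y >] then 0 else om y.

Definition fast_corridor : set config :=
  (\bigcap_(i in [set i | (i < q)%N]) LP (r * L%:R) (alpha i.+1) (alpha i)) `&`
  (\bigcap_(i in [set i | (i < q)%N]) LP (r * L%:R) (beta i) (beta i.+1)) `&`
  [set om | forall y, y \in s1 ++ s2 -> K <= om y].

(** A bypass that starts or ends outside the middle part is enlarged to one
    between block corners, which leaves boundedly many of them. *)
Definition long_bypass i j : set config :=
  LP (r * (level (beta j) - level (alpha i))%:~R) (alpha i) (beta j).

(** A bypass of the middle path alone. It is compared with the vertices of this
    path strictly between [u] and [v], because both ways collect the weight of
    [v]: hence the term [- 1]. *)
Definition short_bypass u v : set config :=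
  LP (K * (level v - level u - 1)%:~R) u v.

Definition no_bypass : set config := [set om |
  (forall i j, (i <= q)%N -> (j <= q)%N -> (0 < i + j)%N ->
     ~ long_bypass i j (off_corridor om)) /\
  (forall u v, u \in alpha 0%N :: s1 -> level u < level z -> v \in s2 ->
     ~ short_bypass u v (off_corridor om))].

Hypothesis alphaS : forall i, (i < q)%N -> le_site (alpha i.+1) (alpha i).
Hypothesis betaS : forall i, (i < q)%N -> le_site (beta i) (beta i.+1).
Hypothesis alphaq : alpha q = origin.
Hypothesis betaq : beta q = (n%:Z, n%:Z).
Hypothesis s1P : up_right_path (alpha 0%N) z s1.
Hypothesis s2P : up_right_path z (beta 0%N) s2.
Hypothesis z_level : level z = n.
Hypothesis L_gt0 : (0 < L)%N.
Hypothesis size_s1 : (L <= size s1)%N.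
Hypothesis size_s2 : (L <= size s2)%N.
Hypothesis r_ge0 : 0 <= r.
Hypothesis rK : 6 * r <= K.
Hypothesis gap_le : forall i j, (i <= q)%N -> (j <= q)%N ->
  (level (beta j) - level (alpha i))%:~R <= (i + j + 4)%:R * L%:R :> R.

Lemma alpha_le i : (i <= q)%N -> le_site (alpha i) (alpha 0%N).
Proof.
elim: i => [|i IHi] iq; first exact: le_site_refl.
exact: le_site_trans (alphaS iq) (IHi (ltnW iq)).
Qed.

Lemma beta_le i : (i <= q)%N -> le_site (beta 0%N) (beta i).
Proof.
elim: i => [|i IHi] iq; first exact: le_site_refl.
exact: le_site_trans (IHi (ltnW iq)) (betaS iq).
Qed.

Lemma alpha_z i : (i <= q)%N -> le_site (alpha i) z.
Proof. by move=> iq; exact: le_site_trans (alpha_le iq) (upath_le s1P). Qed.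

Lemma beta_z i : (i <= q)%N -> le_site z (beta i).
Proof. by move=> iq; exact: le_site_trans (upath_le s2P) (beta_le iq). Qed.

(** The corridor is pinched at [z]. *)
Lemma corridor_level y : corridor y -> level y = level z -> y = z.
Proof.
move=> [[i iq /andP[_ yi]]|ys|[i iq /andP[iy _]]] yz.
- apply: le_site_level_eq; last by rewrite yz.
  exact: le_site_trans yi (alpha_z (ltnW iq)).
- move: ys; rewrite inE mem_cat => /or3P[/eqP ya|ys1|ys2].
  + by apply: le_site_level_eq; [rewrite ya; exact: alpha_z|rewrite yz].
  + have [_ yz' _] := upath_mem s1P ys1.
    by apply: le_site_level_eq; rewrite ?yz.
  + by have [_ _] := upath_mem s2P ys2; rewrite yz ltxx.
- apply/esym; apply: le_site_level_eq; last by rewrite yz.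
  exact: le_site_trans (beta_z (ltnW iq)) iy.
Qed.

Lemma off_nneg om : nneg om -> nneg (off_corridor om).
Proof. by move=> om0 y; rewrite /off_corridor; case: asboolP. Qed.

Section on_fast_corridor.
Variable om : config.
Hypothesis om0 : nneg om.
Hypothesis om_fast : fast_corridor om.

Lemma alpha_chain i : (i <= q)%N -> LP (i%:R * (r * L%:R)) (alpha i) (alpha 0%N) om.
Proof.
have [[fa _] _] := om_fast.
elim: i => [|i IHi] iq; first by rewrite mul0r; apply: LP0 => //; exact: le_site_refl.
rewrite -natr1 addrC mulrDl mul1r.
exact: LP_cat (fa i iq) (IHi (ltnW iq)).
Qed.

Lemma beta_chain i : (i <= q)%N -> LP (i%:R * (r * L%:R)) (beta 0%N) (beta i) om.
Proof.
have [[_ fb] _] := om_fast.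
elim: i => [|i IHi] iq; first by rewrite mul0r; apply: LP0 => //; exact: le_site_refl.
rewrite -natr1 mulrDl mul1r.
exact: LP_cat (IHi (ltnW iq)) (fb i iq).
Qed.

Lemma weight_ge p : {subset p <= s1 ++ s2} -> K * (size p)%:R <= path_weight om p.
Proof.
have [_ fK] := om_fast.
elim: p => [|x p IHp] ps; first by rewrite /path_weight big_nil mulr0.
rewrite /path_weight big_cons /= -natr1 mulrDr mulr1 addrC.
apply: lerD; first by apply: fK; apply: ps; rewrite mem_head.
by apply: IHp => y yp; apply: ps; rewrite inE yp orbT.
Qed.

Lemma K_ge0 : 0 <= K. Proof. by apply: le_trans rK; rewrite mulr_ge0. Qed.

Lemma s1_LP : LP (K * L%:R) (alpha 0%N) z om.
Proof.
exists s1 => //; apply: le_trans (weight_ge _); last by move=> y; rewrite mem_cat => ->.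
by rewrite ler_wpM2l ?K_ge0 // ler_nat.
Qed.

Lemma s2_LP : LP (K * L%:R) z (beta 0%N) om.
Proof.
exists s2 => //; apply: le_trans (weight_ge _); last first.
  by move=> y; rewrite mem_cat orbC => ->.
by rewrite ler_wpM2l ?K_ge0 // ler_nat.
Qed.

(** From a site [u] in a block, the rest of this block is crossed without
    counting its weight, then the remaining blocks and [s1] are collected. On
    the middle path the weight depends on [u], and [along_corridor] applies. *)
Lemma enter_corridor u : corridor u -> level u < level z ->
  exists i, [/\ (i <= q)%N, le_site (alpha i) u &
    if i is i'.+1 then LP (i'%:R * (r * L%:R) + K * L%:R) u z om
    else u \in alpha 0%N :: s1].
Proof.
move=> [[i iq /andP[iu ui]]|us|[i iq /andP[iu _]]] uz.
- exists i.+1; split => //; apply: LP_cat s1_LP.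
  exact: LP_widen om0 ui (le_site_refl _) (alpha_chain (ltnW iq)).
- exists 0%N; split => //; move: us; rewrite !inE mem_cat.
    case/or3P => [/eqP ->|us1|us2]; first exact: le_site_refl.
      by have [] := upath_mem s1P us1.
    by have [/le_site_level] := upath_mem s2P us2; rewrite leNgt uz.
  case/or3P => [->//|->|us2]; first by rewrite orbT.
  by have [/le_site_level] := upath_mem s2P us2; rewrite leNgt uz.
- have := le_site_level (le_site_trans (beta_z (ltnW iq)) iu).
  by rewrite leNgt uz.
Qed.

(** The weight of [v] is kept apart because the bypass collects it too. A corner
    is attributed to the block that ends there, so that the last step of the
    way to [v] is not empty. *)
Lemma exit_corridor v : corridor v -> level z < level v ->
  exists j, [/\ (j <= q)%N, le_site v (beta j) &
    if j is j'.+1 then LP (K * L%:R + j'%:R * (r * L%:R) + om v) z v om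
    else v \in s2].
Proof.
move=> [[i iq /andP[_ vi]]|vs|[i iq vi]] zv.
- have := le_site_level (le_site_trans vi (alpha_z (ltnW iq))).
  by rewrite leNgt zv.
- exists 0%N; move: vs; rewrite inE mem_cat => /or3P[/eqP va|vs1|vs2].
  + by have := le_site_level (alpha_z (leq0n q)); rewrite -va leNgt zv.
  + by have [_ /le_site_level] := upath_mem s1P vs1; rewrite leNgt zv.
  + by split => //; have [] := upath_mem s2P vs2.
elim: i iq vi => [|i IHi] iq /andP[iv vi]; last first.
  have [ve|ve] := eqVneq (beta i.+1) v.
    apply: IHi; first exact: ltnW.
    by rewrite -ve le_site_refl andbT; apply: betaS; exact: ltnW.
  exists i.+2; split => //; apply: LP_cat (LP_last om0 iv ve).
  by apply: LP_cat s2_LP (beta_chain _); exact: ltnW.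
have [ve|ve] := eqVneq (beta 0%N) v.
  exists 0%N; split => //; first by rewrite ve le_site_refl.
  move: s2P; rewrite /up_right_path -ve => /andP[_ /eqP <-].
  case: (s2) size_s2 => [|x s] /=; first by move/(leq_trans L_gt0).
  by rewrite mem_last.
exists 1%N; split => //; apply: LP_cat (LP_last om0 iv ve).
by rewrite mul0r addr0; exact: s2_LP.
Qed.

Lemma along_corridor u v : u \in alpha 0%N :: s1 -> v \in s2 ->
  LP (K * (level v - level u - 1)%:~R + om v) u v om.
Proof.
move=> us vs.
have [p1 [p2 [s1E _ p2P]]] := upath_split s1P us.
have [p3 [p4 [s2E p3P _]]] := upath_split s2P (mem_behead (s := z :: s2) vs).
have zv : z != v.
  by apply/eqP => zv; have [_ _] := upath_mem s2P vs; rewrite zv ltxx.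
case/lastP: p3 => [|p3 x] in s2E p3P.
  by move: p3P; rewrite upath_nil (negbTE zv).
have xv : x = v by move: p3P; rewrite /up_right_path last_rcons => /andP[_ /eqP].
have pP := upath_cat p2P p3P; exists (p2 ++ rcons p3 x) => //.
have := upath_size pP; rewrite size_cat size_rcons => sz.
have -> : level v - level u - 1 = (size (p2 ++ p3))%:Z by rewrite size_cat; lia.
rewrite -cats1 catA path_weight_cat path_weight1 xv lerD2r.
apply: weight_ge => y; rewrite s1E s2E -cats1 !mem_cat.
by move=> /orP[] ->; rewrite !orbT.
Qed.

(** A path that avoids [z] leaves the corridor at some [u] before the
    antidiagonal of [z] and comes back at some [v] after it. Replacing its
    excursion by the corridor from [u] through [z] to [v] is profitable. *)
Lemma geodesic_through_z (g : seq site) : no_bypass om ->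
  up_right_path origin (n%:Z, n%:Z) g ->
  (forall p, up_right_path origin (n%:Z, n%:Z) p ->
     path_weight om p <= path_weight om g) ->
  z \in origin :: g.
Proof.
move=> [nolong noshort] gP gmax; apply: contrapT => /negP zg.
have L0 : 0 < L%:R :> R by rewrite ltr0n.
have C0 : corridor origin.
  rewrite -alphaq; have [->|q_gt0] := posnP q; first by apply: Or32; rewrite mem_head.
  have qp : (q.-1 < q)%N by rewrite prednK.
  apply: Or31; exists q.-1 => //; move: (alphaS qp).
  by rewrite prednK // le_site_refl.
have Cn : corridor (n%:Z, n%:Z).
  rewrite -betaq; have [->|q_gt0] := posnP q.
    apply: Or32; rewrite inE mem_cat; apply/or3P/Or33.
    move: s2P; rewrite /up_right_path => /andP[_ /eqP <-].
    case: (s2) size_s2 => [|x s] /=; first by move/(leq_trans L_gt0).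
    by rewrite mem_last.
  have qp : (q.-1 < q)%N by rewrite prednK.
  apply: Or33; exists q.-1 => //; move: (betaS qp).
  by rewrite prednK // le_site_refl andbT.
have [y yg yn] : exists2 y : site, y \in origin :: g & level y = level z.
  apply: upath_level_ex gP _; rewrite z_level /level /=; lia.
have nCy : ~ corridor y.
  by move=> /corridor_level/(_ yn) yz; move: zg; rewrite -yz yg.
have [g1 [g2 [gE g1P g2P]]] := upath_split gP yg.
have [|u [p1 [p2 [g1E p1P p2P Cu nCp2]]]] := upath_last_visit (C := corridor) g1P.
  by exists origin; rewrite ?mem_head.
have [|v [p3 [p4 [g2E p3P p4P Cv nCp3]]]] := upath_first_visit (C := corridor) g2P.
  case: g2 {gE} g2P => [|x g2]; first by rewrite upath_nil => /eqP yE; rewrite yE in nCy.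
  move=> /andP[_ /eqP lE]; exists (n%:Z, n%:Z) => //.
  by rewrite -lE /= mem_last.
have uz : level u < level z.
  have uy := le_site_level (upath_le p2P); rewrite -yn lt_neqAle uy andbT.
  apply/negP => /eqP uyE; apply: nCy.
  by rewrite -(le_site_level_eq (upath_le p2P)) // uyE.
have zv : level z < level v.
  by have [|_ _] := upath_mem p3P (_ : v \in _); rewrite ?mem_cat ?mem_head ?orbT // yn.
pose m := p2 ++ p3; pose W := path_weight om m.
have mP : up_right_path u v (m ++ [:: v]) by rewrite -catA; exact: upath_cat p2P p3P.
have gm : g = p1 ++ (m ++ [:: v]) ++ p4 by rewrite gE g1E g2E /m -!catA.
(* The excursion is optimal among all paths with the same ends. *)
have Wmax s : LP s u v om -> s <= W + om v.
  move=> [p pP sp]; apply: (le_trans sp).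
  have := gmax _ (upath_cat p1P (upath_cat pP p4P)).
  rewrite gm !path_weight_cat path_weight1; rewrite /W /m path_weight_cat; lra.
have Woff : LP W u v (off_corridor om).
  exists (m ++ [:: v]) => //; rewrite path_weight_cat path_weight1.
  rewrite {2}/off_corridor; case: asboolP => // _; rewrite addr0 /W /path_weight.
  rewrite le_eqVlt; apply/orP; left; apply/eqP; apply: eq_big_seq => x xm.
  rewrite /off_corridor; case: asboolP => // Cx; exfalso.
  by move: xm; rewrite mem_cat => /orP[/nCp2|/nCp3]; exact.
have [i [iq iu ui]] := enter_corridor Cu uz.
have [j [jq vj vz]] := exit_corridor Cv zv.
have bypass : (0 < i + j)%N -> W < r * ((i + j + 4)%:R * L%:R).
  move=> ij; rewrite ltNge; apply/negP => h.
  apply: (nolong i j iq jq ij); apply: LP_mono (LP_widen (off_nneg om0) iu vj Woff).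
  by apply: le_trans h; apply: ler_wpM2l => //; exact: gap_le.
have uzP : le_site u z.
  case: (Cu) => [[i' i'q /andP[_ h]]|us|[i' i'q /andP[h _]]].
  - exact: le_site_trans h (alpha_z (ltnW i'q)).
  - move: us; rewrite inE mem_cat => /or3P[/eqP ->|us1|us2].
    + exact: alpha_z.
    + by have [] := upath_mem s1P us1.
    + by have [/le_site_level] := upath_mem s2P us2; rewrite leNgt uz.
  - by have /le_site_level := le_site_trans (beta_z (ltnW i'q)) h; rewrite leNgt uz.
have rL : 0 <= r * L%:R by rewrite mulr_ge0.
have KL : 6 * (r * L%:R) <= K * L%:R by rewrite mulrA ler_pM2r.
case: i iq iu ui bypass => [|i] iq iu ui; case: j jq vj vz => [|j] jq vj vz bypass.
- have := Wmax _ (along_corridor ui vz); rewrite lerD2r => KW.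
  exact: (noshort u v ui uz vz (LP_mono KW Woff)).
- have := Wmax _ (LP_cat (LP0 om0 uzP) vz).
  by have := bypass isT; rewrite !natrD -natr1; lra.
- have zv' : le_site z v by have [] := upath_mem s2P vz.
  have zNv : z != v by apply/eqP => zE; move: zv; rewrite zE ltxx.
  have := Wmax _ (LP_cat ui (LP_last om0 zv' zNv)).
  by have := bypass isT; rewrite !natrD -natr1; lra.
- have := Wmax _ (LP_cat ui vz).
  by have := bypass isT; rewrite !natrD -!natr1; lra.
Qed.

End on_fast_corridor.
End detour.

(** * Probability of a fast corridor without bypasses *)

Section geometric_sums_along_paths.
Context {R : realType}.
Implicit Types (u v : int * int) (y : R).

(** A path meets each antidiagonal once, so sums over it of a function of the
    level are sums over levels. *)
Lemma sum_from_start u v p y : up_right_path u v p ->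
  \sum_(x <- p) y ^+ `|level x - level u|%N = \sum_(0 <= j < size p) y ^+ j.+1.
Proof.
move=> pP.
have gen k (u' : int * int) : up_right_path u' v p -> level u' = level u + k%:Z ->
    \sum_(x <- p) y ^+ `|level x - level u|%N = \sum_(0 <= j < size p) y ^+ (k + j).+1.
  elim: p u' k {pP} => [|x p IHp] u' k; first by rewrite !big_nil.
  rewrite upath_cons => /andP[ux pp] uk; rewrite big_cons big_nat_recl //= addn0.
  have xk : level x = level u + k.+1%:Z.
    by move: ux uk => /orP[] /eqP ->; rewrite /level /=; lia.
  rewrite (IHp _ _ pp xk); congr (_ ^+ _ + _); first by lia.
  by apply: eq_bigr => j _; rewrite addSnnS.
by rewrite (gen 0%N u) ?addr0.
Qed.

Lemma sum_to_end u v p y : up_right_path u v p ->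
  \sum_(x <- belast u p) y ^+ `|level v - level x|%N = \sum_(0 <= j < size p) y ^+ j.+1.
Proof.
elim: p u => [|x p IHp] u; first by rewrite !big_nil.
move=> pP; have /= sz := upath_size pP; move: pP.
rewrite upath_cons => /andP[ux pp]; rewrite big_cons (IHp _ pp) big_nat_recr //=.
have -> : `|level v - level u|%N = (size p).+1 by lia.
by rewrite addrC.
Qed.

Lemma sum_geometric1_le y m : 0 <= y -> y <= 4^-1 ->
  \sum_(0 <= j < m) y ^+ j.+1 <= 3^-1.
Proof.
move=> y0 y4; have y1 : y < 1 by lra.
under eq_bigr do rewrite exprS.
rewrite -mulr_sumr; apply: (@le_trans _ _ (y * (1 - y)^-1)).
  by apply: ler_wpM2l => //; exact: sum_geometric_le.
by rewrite ler_pdivrMr; lra.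
Qed.

Lemma belast_level u v p x : up_right_path u v p -> x \in belast u p ->
  level x < level v.
Proof.
elim: p u => //= y p IHp u pP; have /= sz := upath_size pP; move: pP.
rewrite upath_cons => /andP[_ pp]; rewrite inE => /predU1P[->|]; first by lia.
exact: IHp.
Qed.

End geometric_sums_along_paths.

Section corridor_probability.
Context {d : measure_display} {T : measurableType d} {R : realType}.
Variables (P : probability T R) (w : int * int -> {RV P >-> R}).
Hypothesis w_ge0 : forall z x, 0 <= w z x.
Hypothesis w_indep : mutually_independent w.
Hypothesis w_id : identically_distributed w.
Local Notation site := (int * int)%type.
Local Notation config := (site -> R).
Local Notation Pr := (Pr w).
Implicit Types (u v y : site) (om : config) (s : R).

Variables (q : nat) (alpha beta : nat -> site) (z : site) (s1 s2 : seq site).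
Variables (L : nat) (r K pL : R).
Hypothesis alphaS : forall i, (i < q)%N -> le_site (alpha i.+1) (alpha i).
Hypothesis betaS : forall i, (i < q)%N -> le_site (beta i) (beta i.+1).
Hypothesis s1P : up_right_path (alpha 0%N) z s1.
Hypothesis s2P : up_right_path z (beta 0%N) s2.
Hypothesis alpha_pL : forall i, (i < q)%N ->
  Pr (LP (r * L%:R) (alpha i.+1) (alpha i)) = pL.
Hypothesis beta_pL : forall i, (i < q)%N ->
  Pr (LP (r * L%:R) (beta i) (beta i.+1)) = pL.

Local Notation corridor := (corridor q alpha beta s1 s2).
Local Notation off := (off_corridor q alpha beta s1 s2).
Local Notation fast := (fast_corridor q alpha beta s1 s2 L r K).
Local Notation clear := (no_bypass q alpha beta z s1 s2 r K).

Definition slab (a b : int) : set site := [set y | a < level y <= b].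

Lemma depends_LP_slab s u v : depends (slab (level u) (level v)) (LP s u v).
Proof.
apply: depends_mono (@depends_LP _ s u v) => y [_ /le_site_level yv uy].
by rewrite /slab /= uy yv.
Qed.

Definition left_fast k : set config :=
  \bigcap_(i in [set i | (i < k)%N]) LP (r * L%:R) (alpha i.+1) (alpha i).

Definition right_fast k : set config :=
  \bigcap_(i in [set i | (i < k)%N]) LP (r * L%:R) (beta i) (beta i.+1).

Lemma bigcap_ltS (F : nat -> set config) k :
  \bigcap_(i in [set i | (i < k.+1)%N]) F i =
  \bigcap_(i in [set i | (i < k)%N]) F i `&` F k.
Proof.
apply/seteqP; split=> om.
  by move=> h; split=> [i /= ik|]; apply: h => //=; exact: ltnW.
by move=> [h Fk] i /=; rewrite ltnS leq_eqVlt => /predU1P[->//|]; exact: h.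
Qed.

(** The blocks lie between consecutive antidiagonals, hence are independent. *)
Lemma Pr_left_fast k : (k <= q)%N ->
  depends (slab (level (alpha k)) (level (alpha 0%N))) (left_fast k) /\
  Pr (left_fast k) = pL ^+ k.
Proof.
elim: k => [|k IHk] kq.
  have -> : left_fast 0 = setT by apply/seteqP; split.
  by split; [exact: dependsT|rewrite Pr_setT].
have [dk Pk] := IHk (ltnW kq); rewrite /left_fast bigcap_ltS -/(left_fast k).
have lS := le_site_level (alphaS kq).
have l0 : level (alpha k) <= level (alpha 0%N).
  exact: le_site_level (alpha_le alphaS (ltnW kq)).
split.
  apply: dependsI; first by apply: depends_mono dk => y; rewrite /slab /=; lia.
  by apply: depends_mono (@depends_LP_slab _ _ _) => y; rewrite /slab /=; lia.
rewrite (Pr_indep w_indep _ dk (@depends_LP_slab _ _ _)) ?Pk ?alpha_pL ?exprSr //.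
by apply/seteqP; split => // y; rewrite /slab /= => -[]; lia.
Qed.

Lemma Pr_right_fast k : (k <= q)%N ->
  depends (slab (level (beta 0%N)) (level (beta k))) (right_fast k) /\
  Pr (right_fast k) = pL ^+ k.
Proof.
elim: k => [|k IHk] kq.
  have -> : right_fast 0 = setT by apply/seteqP; split.
  by split; [exact: dependsT|rewrite Pr_setT].
have [dk Pk] := IHk (ltnW kq); rewrite /right_fast bigcap_ltS -/(right_fast k).
have lS := le_site_level (betaS kq).
have l0 : level (beta 0%N) <= level (beta k).
  exact: le_site_level (beta_le betaS (ltnW kq)).
split.
  apply: dependsI; first by apply: depends_mono dk => y; rewrite /slab /=; lia.
  by apply: depends_mono (@depends_LP_slab _ _ _) => y; rewrite /slab /=; lia.
rewrite (Pr_indep w_indep _ dk (@depends_LP_slab _ _ _)) ?Pk ?beta_pL ?exprSr //.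
by apply/seteqP; split => // y; rewrite /slab /= => -[]; lia.
Qed.

Definition heavy_middle : set config := cylinder (s1 ++ s2) (fun=> `[K, +oo[%classic).

Lemma heavy_middleE : heavy_middle = [set om | forall y, y \in s1 ++ s2 -> K <= om y].
Proof.
by apply/seteqP; split => om /= h y /h; rewrite /= in_itv /= andbT.
Qed.

Lemma Pr_heavy_middle :
  Pr heavy_middle = Pr [set om | K <= om origin] ^+ (size s1 + size s2).
Proof.
rewrite /heavy_middle Pr_cylinder //; last first.
  exact: upath_uniq (upath_cat s1P s2P).
rewrite (eq_bigr (fun=> Pr [set om | K <= om origin])) => [|y _].
  by rewrite big_const_seq count_predT iter_mulr mulr1 size_cat.
rewrite (Pr_coord w_id y origin (measurable_itv _)); congr Pr.
by apply/seteqP; split => om; rewrite /= in_itv /= andbT.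
Qed.

Lemma Pr_fast : Pr fast =
  pL ^+ (2 * q) * Pr [set om | K <= om origin] ^+ (size s1 + size s2).
Proof.
have [dl Pl] := Pr_left_fast (leqnn q); have [dr Pr_r] := Pr_right_fast (leqnn q).
have lz := le_site_level (upath_le s1P); have zl := le_site_level (upath_le s2P).
have dm : depends (slab (level (alpha 0%N)) (level (beta 0%N))) heavy_middle.
  apply: depends_cylinder => // y /=; rewrite mem_cat /slab /= => /orP[ys1|ys2].
    by have [_ /le_site_level h1 h2] := upath_mem s1P ys1; lia.
  by have [_ /le_site_level h1 h2] := upath_mem s2P ys2; lia.
rewrite /fast_corridor -/(left_fast q) -/(right_fast q) -heavy_middleE.
rewrite (Pr_indep w_indep (S1 := slab (level (alpha q)) (level (alpha 0%N)) `|`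
  slab (level (beta 0%N)) (level (beta q))) _ _ dm); last 2 first.
- by apply/seteqP; split => // y; rewrite /slab /= => -[]; lia.
- by apply: dependsI; [apply: depends_mono dl|apply: depends_mono dr];
    move=> y ys; [left|right].
rewrite (Pr_indep w_indep _ dl dr); last first.
  by apply/seteqP; split => // y; rewrite /slab /= => -[]; lia.
by rewrite Pl Pr_r Pr_heavy_middle -exprD mul2n addnn.
Qed.

Lemma depends_fast : depends corridor fast.
Proof.
rewrite /fast_corridor -heavy_middleE; apply: dependsI; first apply: dependsI.
- apply: depends_all => i iq; apply: depends_mono (@depends_LP _ _ _ _) => y [h1 h2 _].
  by apply: Or31; exists i; rewrite ?h1.
- apply: depends_all => i iq; apply: depends_mono (@depends_LP _ _ _ _) => y [h1 h2 _].
  by apply: Or33; exists i; rewrite ?h1.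
- apply: depends_cylinder => // y ys; apply: Or32.
  by rewrite inE [y \in _ ++ _]ys orbT.
Qed.

Lemma depends_off (A : set config) : depends setT A ->
  depends (~` corridor) [set om : config | A (off om)].
Proof.
apply: (depends_preimage (h := fun om : config => off om)) => y B _ mB.
have [Cy|nCy] := pselect (corridor y); last first.
  rewrite (_ : [set om : config | _] = [set om : config | B (om y)]); first exact: depends_coord.
  by apply/seteqP; split => om; rewrite /= /off_corridor; case: asboolP.
have [B0|nB0] := pselect (B 0).
  rewrite (_ : [set om | _] = setT); first exact: dependsT.
  by apply/seteqP; split => om; rewrite /= /off_corridor; case: asboolP.
rewrite (_ : [set om | _] = ~` setT); first by apply: dependsC; exact: dependsT.
by rewrite setCT; apply/seteqP; split => om; rewrite /= /off_corridor; case: asboolP.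
Qed.

Lemma LP_off om s u v : nneg om -> LP s u v (off om) -> LP s u v om.
Proof.
move=> om0 [p pP sp]; exists p => //; apply: (le_trans sp).
rewrite /path_weight; apply: ler_sum => y _; rewrite /off_corridor.
by case: asboolP.
Qed.

(** Erasing weights only decreases passage times. *)
Lemma Pr_LP_off s u v : Pr [set om | LP s u v (off om)] <= Pr (LP s u v).
Proof.
apply: (Pr_le w_ge0 (S := setT)); last by move=> om om0; exact: LP_off.
  by apply: depends_mono (depends_off (@depends_LPT _ s u v)).
exact: depends_LPT.
Qed.

Definition bypass_pairs : seq (nat * nat) :=
  [seq p <- [seq (i, j) | i <- iota 0 q.+1, j <- iota 0 q.+1] | (0 < p.1 + p.2)%N].

Definition short_pairs : seq (site * site) :=
  [seq (u, v) | u <- belast (alpha 0%N) s1, v <- s2].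

Lemma not_clear om : ~ clear om ->
  (exists2 p, p \in bypass_pairs & long_bypass alpha beta r p.1 p.2 (off om)) \/
  (exists2 p, p \in short_pairs & short_bypass K p.1 p.2 (off om)).
Proof.
apply: contra_notP => /not_orP[nl ns]; split=> [i j iq jq ij lb|u v us uz vs sb].
  apply: nl; exists (i, j) => //; rewrite mem_filter; apply/andP; split => //.
  by apply/allpairsP; exists (i, j); split; rewrite ?mem_iota //= ltnS.
apply: ns; exists (u, v) => //; apply/allpairsP; exists (u, v); split => //=.
move: us; rewrite lastI mem_rcons inE; case/predU1P => // uE.
by move: s1P uz; rewrite /up_right_path uE => /andP[_ /eqP ->]; rewrite ltxx.
Qed.

Lemma clearE : clear = ~` (
  (\bigcup_(p in [set` bypass_pairs]) [set om | long_bypass alpha beta r p.1 p.2 (off om)]) `|`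
  (\bigcup_(p in [set` short_pairs]) [set om | short_bypass K p.1 p.2 (off om)])).
Proof.
apply/seteqP; split=> om.
  move=> [nl ns] [[[i j] /= pb lb]|[[u v] /= pb sb]].
    move: pb; rewrite mem_filter => /andP[ij /allpairsP[[i' j'] [iq jq [iE jE]]]].
    move: iq jq; rewrite !mem_iota /= -iE -jE !ltnS => iq jq.
    exact: (nl i j iq jq ij lb).
  move: pb => /allpairsP[[u' v'] [/= us vs [uE vE]]]; rewrite -uE -vE in us vs.
  apply: (ns u v _ _ vs sb); first by rewrite lastI mem_rcons inE us orbT.
  exact: belast_level s1P us.
by move=> nb; apply: contrapT => /not_clear[[p pb lb]|[p pb sb]]; apply: nb;
  [left|right]; exists p.
Qed.

Lemma depends_clear : depends (~` corridor) clear.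
Proof.
rewrite clearE; apply: dependsC; apply: dependsU; apply: depends_ex => p _;
  exact: depends_off (@depends_LPT _ _ _ _).
Qed.

Variables (eta A b : R).
Hypothesis long_small : forall i j, (i <= q)%N -> (j <= q)%N ->
  Pr (long_bypass alpha beta r i j) <= eta.
Hypothesis eta_small : (q.+1 * q.+1)%:R * eta <= 4^-1.
Hypothesis A1 : 1 <= A.
Hypothesis b_gt0 : 0 < b.
Hypothesis K_ge0 : 0 <= K.
Hypothesis tail : forall u v (k : nat) s, level v - level u = k ->
  Pr (LP s u v) <= (2 * A) ^+ k * expR (- (b * s)).
Hypothesis y_small : 2 * A * expR (- (b * K / 2)) <= 4^-1.

(** The number [2 ^ k] of paths and the prefactor [A ^ k] of the Chernoff bound
    are both absorbed by [K]; this uses [k - 1 >= k / 2]. Splitting the bound at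
    the level of [z] makes the sum over all pairs a product. *)
Lemma Pr_short_bypass u v : level u < level z -> level z < level v ->
  Pr (short_bypass K u v) <=
  (2 * A * expR (- (b * K / 2))) ^+ `|level z - level u|%N *
  (2 * A * expR (- (b * K / 2))) ^+ `|level v - level z|%N.
Proof.
move=> uz zv; rewrite -exprD; set k := (_ + _)%N.
have kE : level v - level u = k%:Z by rewrite /k; lia.
have k2 : (2 <= k)%N by rewrite /k; lia.
apply: (le_trans (tail _ kE)); rewrite [leRHS]exprMn -expRM_natl kE.
apply: ler_wpM2l; first by rewrite exprn_ge0 // mulr_ge0 // (le_trans ler01).
rewrite ler_expR intrB -pmulrn.
have bK : 0 <= b * K by rewrite mulr_ge0 // ltW.
have k2R : 2 <= k%:R :> R by rewrite ler_nat.
have h : b * K * (k%:R / 2) <= b * K * (k%:R - 1) by apply: ler_wpM2l => //; lra.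
by lra.
Qed.

Lemma Pr_clear : 2^-1 <= Pr clear.
Proof.
pose y := 2 * A * expR (- (b * K / 2)).
have y0 : 0 <= y by rewrite /y !mulr_ge0 ?expR_ge0 // (le_trans ler01).
have dl (p : nat * nat) : depends (~` corridor)
    [set om | long_bypass alpha beta r p.1 p.2 (off om)].
  exact: depends_off (@depends_LPT _ _ _ _).
have ds (p : site * site) : depends (~` corridor)
    [set om | short_bypass K p.1 p.2 (off om)].
  exact: depends_off (@depends_LPT _ _ _ _).
have dU1 : depends (~` corridor) (\bigcup_(p in [set` bypass_pairs])
    [set om | long_bypass alpha beta r p.1 p.2 (off om)]) by exact: depends_ex.
have dU2 : depends (~` corridor) (\bigcup_(p in [set` short_pairs])
    [set om | short_bypass K p.1 p.2 (off om)]) by exact: depends_ex.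
rewrite clearE (Pr_setC _ (dependsU dU1 dU2)).
suff : Pr (\bigcup_(p in [set` bypass_pairs])
      [set om | long_bypass alpha beta r p.1 p.2 (off om)] `|`
    \bigcup_(p in [set` short_pairs])
      [set om | short_bypass K p.1 p.2 (off om)]) <= 4^-1 + 4^-1 by lra.
apply: (le_trans (Pr_setU _ dU1 dU2)); apply: lerD.
  apply: le_trans (Pr_union_bound _ (fun p _ => dl p)) _.
  apply: le_trans eta_small.
  apply: (@le_trans _ _ (\sum_(p <- bypass_pairs) eta)).
    rewrite big_seq [leRHS]big_seq; apply: ler_sum => -[i j].
    rewrite mem_filter => /andP[_ /allpairsP[[i' j'] [iq jq [-> ->]]]].
    move: iq jq; rewrite !mem_iota /= !ltnS => iq jq.
    exact: le_trans (Pr_LP_off _ _ _) (long_small iq jq).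
  have eta0 : 0 <= eta by exact: le_trans (Pr_ge0 _ _) (long_small (leq0n q) (leq0n q)).
  rewrite big_const_seq count_predT iter_addr addr0 -[leLHS]mulr_natl.
  apply: ler_wpM2r => //; rewrite ler_nat size_filter.
  by apply: (leq_trans (count_size _ _)); rewrite size_allpairs !size_iota.
apply: le_trans (Pr_union_bound _ (fun p _ => ds p)) _.
apply: (@le_trans _ _ (\sum_(p <- short_pairs)
    y ^+ `|level z - level p.1|%N * y ^+ `|level p.2 - level z|%N)).
  rewrite big_seq [leRHS]big_seq; apply: ler_sum => -[u v].
  move=> /allpairsP[[u' v'] [/= us vs [-> ->]]] /=.
  apply: (le_trans (Pr_LP_off _ _ _)); apply: Pr_short_bypass.
    exact: belast_level s1P us.
  by have [] := upath_mem s2P vs.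
rewrite big_allpairs /=; under eq_bigr do rewrite -mulr_sumr.
rewrite -mulr_suml (sum_to_end _ s1P) (sum_from_start _ s2P).
apply: (@le_trans _ _ (3^-1 * 3^-1)); last by lra.
apply: ler_pM; rewrite ?sumr_ge0 //; try exact: sum_geometric1_le.
  by move=> j _; rewrite exprn_ge0.
by move=> j _; rewrite exprn_ge0.
Qed.

Variable n : nat.
Hypothesis alphaq : alpha q = origin.
Hypothesis betaq : beta q = (n%:Z, n%:Z).
Hypothesis z_level : level z = n.
Hypothesis L_gt0 : (0 < L)%N.
Hypothesis size_s1 : (L <= size s1)%N.
Hypothesis size_s2 : (L <= size s2)%N.
Hypothesis r_ge0 : 0 <= r.
Hypothesis rK : 6 * r <= K.
Hypothesis gap_le : forall i j, (i <= q)%N -> (j <= q)%N ->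
  (level (beta j) - level (alpha i))%:~R <= (i + j + 4)%:R * L%:R :> R.

(** A fast corridor and the absence of bypasses depend on complementary sets
    of sites. *)
Lemma Pr_mid_eq :
  pL ^+ (2 * q) * Pr [set om | K <= om origin] ^+ (size s1 + size s2) * 2^-1 <=
  Pr [set om | mid om n = z].
Proof.
rewrite -Pr_fast; apply: (@le_trans _ _ (Pr fast * Pr clear)).
  by apply: ler_wpM2l; [exact: Pr_ge0|exact: Pr_clear].
rewrite -(Pr_indep w_indep _ depends_fast depends_clear); last by rewrite setICr.
apply: (Pr_le w_ge0 (S := setT)).
- apply: dependsI; first exact: depends_mono depends_fast.
  exact: depends_mono depends_clear.
- exact: (@depends_mid _ n [set y | y = z]).
move=> om om0 [om_fast om_clear].
have /(is_geodesic_geodesic om)/geodesicP[gP gmax] : le_site origin (n%:Z, n%:Z).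
  by rewrite /le_site /=.
have [mg ml] := midP om n.
have zg := geodesic_through_z alphaS betaS alphaq betaq s1P s2P z_level L_gt0
  size_s1 size_s2 r_ge0 rK gap_le om0 om_fast om_clear gP gmax.
by apply: (upath_level_inj gP mg zg); rewrite ml z_level.
Qed.

End corridor_probability.

(** * Blocks along a direction *)

Section corners.
Local Notation site := (int * int)%type.
Implicit Types (c : site) (q n i : nat).

Definition left_corner q c i : site :=
  ((q%:Z - i%:Z) * c.1, (q%:Z - i%:Z) * c.2).

(** Image of [left_corner] under the reflection in the antidiagonal. *)
Definition right_corner n q c i : site :=
  (n%:Z - (q%:Z - i%:Z) * c.2, n%:Z - (q%:Z - i%:Z) * c.1).

Lemma left_corner_level q c i :
  level (left_corner q c i) = (q%:Z - i%:Z) * level c.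
Proof. by rewrite /level /=; ring. Qed.

Lemma right_corner_level n q c i :
  level (right_corner n q c i) = 2 * n%:Z - (q%:Z - i%:Z) * level c.
Proof. by rewrite /level /=; ring. Qed.

Lemma left_corner_step q c i :
  ((left_corner q c i).1 - (left_corner q c i.+1).1,
   (left_corner q c i).2 - (left_corner q c i.+1).2) = c.
Proof.
rewrite [RHS]surjective_pairing /left_corner /= -(addn1 i) PoszD.
by congr (_, _); ring.
Qed.

Lemma right_corner_step n q c i :
  ((right_corner n q c i.+1).1 - (right_corner n q c i).1,
   (right_corner n q c i.+1).2 - (right_corner n q c i).2) = swap c.
Proof. by rewrite /swap /right_corner /= -(addn1 i) PoszD; congr (_, _); ring. Qed.

Lemma left_corner_le q c i : le_site origin c ->
  le_site (left_corner q c i.+1) (left_corner q c i).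
Proof. by rewrite -{1}(left_corner_step q c i) /le_site /= !subr_ge0. Qed.

Lemma right_corner_le n q c i : le_site origin c ->
  le_site (right_corner n q c i) (right_corner n q c i.+1).
Proof.
rewrite (_ : le_site origin c = le_site origin (swap c)); last by rewrite /le_site andbC.
by rewrite -(right_corner_step n q c i) /le_site /= !subr_ge0.
Qed.

Lemma corner_gap n q c (i j L : nat) : (i <= q)%N -> (j <= q)%N ->
  level c <= L%:Z -> n%:Z - q%:Z * level c <= 2 * L%:Z ->
  level (right_corner n q c j) - level (left_corner q c i) <=
  (i + j + 4)%N%:Z * L%:Z.
Proof.
move=> iq jq cL nL; rewrite left_corner_level right_corner_level.
have h : (i%:Z + j%:Z) * level c <= (i%:Z + j%:Z) * L%:Z by apply: ler_wpM2l.
have -> : (i + j + 4)%N%:Z = i%:Z + j%:Z + 4 by lia.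
move: (level c) h nL {cL} => l h nL.
have -> : 2 * n%:Z - (q%:Z - j%:Z) * l - (q%:Z - i%:Z) * l =
  2 * (n%:Z - q%:Z * l) + (i%:Z + j%:Z) * l by ring.
rewrite mulrDl; lia.
Qed.

Lemma corner_gap_ge n q c (i j L : nat) : 0 <= level c ->
  L%:Z <= n%:Z - q%:Z * level c ->
  L%:Z <= level (right_corner n q c j) - level (left_corner q c i).
Proof.
move=> c0 nL; rewrite left_corner_level right_corner_level.
have h : 0 <= (i%:Z + j%:Z) * level c by rewrite mulr_ge0.
have -> : 2 * n%:Z - (q%:Z - j%:Z) * level c - (q%:Z - i%:Z) * level c =
  2 * (n%:Z - q%:Z * level c) + (i%:Z + j%:Z) * level c by ring.
lia.
Qed.

(** The roundings of [n / (q + 1)] and of the blocks lose at most [2 q <= L]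
    sites together. *)
Lemma middle_length q (L n : nat) (l : int) : (L * q.+1 <= n)%N ->
  (n < L.+1 * q.+1)%N -> (2 * q <= L)%N -> L%:Z - 1 <= l -> l <= L%:Z ->
  L%:Z <= n%:Z - q%:Z * l /\ n%:Z - q%:Z * l <= 2 * L%:Z.
Proof.
move=> n1 n2 qL l1 l2.
have q1 : q%:Z * l <= q%:Z * L%:Z by apply: ler_wpM2l.
have q2 : q%:Z * (L%:Z - 1) <= q%:Z * l by apply: ler_wpM2l.
by split; lia.
Qed.

End corners.

Section lower_bound_rate.
Context {d : measure_display} {T : measurableType d} {R : realType}.
Variables (P : probability T R) (w : int * int -> {RV P >-> R}).
Hypothesis w_ge0 : forall z x, 0 <= w z x.
Hypothesis w_indep : mutually_independent w.
Hypothesis w_id : identically_distributed w.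
Local Notation site := (int * int)%type.
Local Notation Pr := (Pr w).
Implicit Types (t r e eps : R) (c : site).

Definition mid_target t (n : nat) : site :=
  (Num.floor (n%:R / 2 + t * n%:R), n%:Z - Num.floor (n%:R / 2 + t * n%:R)).

Lemma endpoint_level t n :
  n%:Z - 1 <= level (endpoint t n) <= n%:Z.
Proof.
rewrite /level /endpoint /=.
set x := n%:R / 2 + t * n%:R; set y := n%:R / 2 - t * n%:R.
have xy : x + y = n%:R by rewrite /x /y; lra.
have /andP[x1 x2] := floor_itv x; have /andP[y1 y2] := floor_itv y.
rewrite !intrD in x2 y2.
have h1 : (Num.floor x + Num.floor y)%:~R <= (n%:Z)%:~R :> R.
  by rewrite intrD -pmulrn; lra.
have h2 : (n%:Z)%:~R < (Num.floor x + Num.floor y + 2)%:~R :> R.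
  by rewrite !intrD -pmulrn; lra.
rewrite ler_int in h1; rewrite ltr_int in h2; lia.
Qed.

Lemma endpoint_ge0 t n : - 2^-1 <= t <= 2^-1 -> le_site origin (endpoint t n).
Proof.
move=> /andP[t1 t2]; rewrite /le_site /endpoint /= !floor_ge0.
have n0 : 0 <= n%:R :> R by [].
have h1 : 0 <= (2^-1 + t) * n%:R by rewrite mulr_ge0 //; lra.
have h2 : 0 <= (2^-1 - t) * n%:R by rewrite mulr_ge0 //; lra.
by apply/andP; split; lra.
Qed.

(** The blocks fit before the target: rounding each block down loses at least as
    much as rounding the target, whose second coordinate is rounded up. *)
Lemma endpoint_mid_target t q L n : - 2^-1 <= t <= 2^-1 -> (L * q <= n)%N ->
  q%:Z * (endpoint t L).1 <= (mid_target t n).1 /\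
  q%:Z * (endpoint t L).2 <= (mid_target t n).2.
Proof.
move=> /andP[t1 t2] Lqn; rewrite /mid_target /endpoint /=.
have qL : q%:R * L%:R <= n%:R :> R by rewrite -natrM ler_nat mulnC.
have q0 : 0 <= q%:R :> R by [].
have f1 := floor_le (L%:R / 2 + t * L%:R); have f2 := floor_le (L%:R / 2 - t * L%:R).
have f3 := floor_le (n%:R / 2 + t * n%:R).
have g1 : q%:R * (Num.floor (L%:R / 2 + t * L%:R))%:~R <= q%:R * (L%:R / 2 + t * L%:R).
  exact: ler_wpM2l.
have g2 : q%:R * (Num.floor (L%:R / 2 - t * L%:R))%:~R <= q%:R * (L%:R / 2 - t * L%:R).
  exact: ler_wpM2l.
have h1 : (2^-1 + t) * (q%:R * L%:R) <= (2^-1 + t) * n%:R by apply: ler_wpM2l => //; lra.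
have h2 : (2^-1 - t) * (q%:R * L%:R) <= (2^-1 - t) * n%:R by apply: ler_wpM2l => //; lra.
split; first by rewrite floor_ge_int intrM -pmulrn; lra.
by rewrite -(ler_int R) intrM intrB -!pmulrn; lra.
Qed.

Variables (q L n N : nat) (t r K eta A b : R).
Hypothesis ht : - 2^-1 <= t <= 2^-1.
Hypothesis Lq_le : (L * q.+1 <= n)%N.
Hypothesis Lq_gt : (n < L.+1 * q.+1)%N.
Hypothesis L_gt0 : (0 < L)%N.
Hypothesis L_ge : (2 * q <= L)%N.
Hypothesis NL : (N <= L)%N.
Hypothesis r_ge0 : 0 <= r.
Hypothesis rK : 6 * r <= K.
Hypothesis small : forall z, N%:Z <= level z ->
  Pr (LP (r * (level z)%:~R) origin z) <= eta.
Hypothesis eta_small : (q.+1 * q.+1)%:R * eta <= 4^-1.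
Hypothesis A1 : 1 <= A.
Hypothesis b_gt0 : 0 < b.
Hypothesis tail : forall u v (k : nat) s, level v - level u = k ->
  Pr (LP s u v) <= (2 * A) ^+ k * expR (- (b * s)).
Hypothesis y_small : 2 * A * expR (- (b * K / 2)) <= 4^-1.

(** Blocks in direction [t] before the midpoint and transposed blocks after
    it. *)
Lemma Pr_mid_target : exists2 m, (m <= 4 * L)%N &
  Pr (LP (r * L%:R) origin (endpoint t L)) ^+ (2 * q) *
    Pr [set om | K <= om origin] ^+ m * 2^-1 <=
  Pr [set om | (mid om n).1 = Num.floor (n%:R / 2 + t * n%:R)].
Proof.
set c := endpoint t L; set z := mid_target t n.
have /andP[cL1 cL2] := endpoint_level t L; rewrite -/c in cL1 cL2.
have [qz1 qz2] : q%:Z * c.1 <= z.1 /\ q%:Z * c.2 <= z.2.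
  by apply: endpoint_mid_target => //; apply: leq_trans Lq_le; rewrite leq_mul2l leqnSn orbT.
have [c1 c2] : 0 <= c.1 /\ 0 <= c.2 by exact/andP/(endpoint_ge0 L ht).
have zn : level z = n by rewrite /level /z /mid_target /=; lia.
have z1 : z.1 = Num.floor (n%:R / 2 + t * n%:R) by [].
clearbody c z.
pose al := left_corner q c; pose be := right_corner n q c.
have c0 : le_site origin c by rewrite /le_site c1 c2.
have [ell1 ell2] := middle_length Lq_le Lq_gt L_ge cL1 cL2.
have alS i : (i < q)%N -> le_site (al i.+1) (al i) by move=> _; exact: left_corner_le.
have beS i : (i < q)%N -> le_site (be i) (be i.+1) by move=> _; exact: right_corner_le.
have alz : le_site (al 0%N) z.
  by rewrite /le_site /al /left_corner /= subr0 qz1.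
have zbe : le_site z (be 0%N).
  rewrite /le_site /be /right_corner /= subr0 !lerBrDl -zn /level.
  by rewrite lerD2r qz1 addrC lerD2l qz2.
have [s1 s1P] := upath_ex alz; have [s2 s2P] := upath_ex zbe.
have sz1 : (size s1)%:Z = n%:Z - q%:Z * level c.
  by rewrite (upath_size s1P) zn left_corner_level subr0.
have sz2 : (size s2)%:Z = n%:Z - q%:Z * level c.
  by rewrite (upath_size s2P) zn right_corner_level subr0; ring.
have al_pL i : (i < q)%N ->
    Pr (LP (r * L%:R) (al i.+1) (al i)) = Pr (LP (r * L%:R) origin c).
  by move=> iq; rewrite Pr_LP_origin // left_corner_step.
have be_pL i : (i < q)%N ->
    Pr (LP (r * L%:R) (be i) (be i.+1)) = Pr (LP (r * L%:R) origin c).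
  by move=> iq; rewrite Pr_LP_origin // right_corner_step -[RHS]Pr_LP_swap.
have level0 : 0 <= level c by rewrite /level addr_ge0.
have longs i j : (i <= q)%N -> (j <= q)%N -> Pr (long_bypass al be r i j) <= eta.
  move=> iq jq; rewrite /long_bypass Pr_LP_origin //.
  set p := (_, _); have pE : level (be j) - level (al i) = level p.
    by rewrite /p /level /=; ring.
  rewrite pE; apply: small; rewrite -pE.
  apply: le_trans (corner_gap_ge i j level0 ell1).
  by rewrite lez_nat.
have gap i j : (i <= q)%N -> (j <= q)%N ->
    (level (be j) - level (al i))%:~R <= (i + j + 4)%:R * L%:R :> R.
  move=> iq jq; rewrite -natrM pmulrn ler_int PoszM.
  exact: corner_gap.
have aq : al q = origin by rewrite /al /left_corner subrr !mul0r.
have bq : be q = (n%:Z, n%:Z) by rewrite /be /right_corner subrr !mul0r subr0.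
have Ls1 : (L <= size s1)%N by rewrite -lez_nat sz1.
have Ls2 : (L <= size s2)%N by rewrite -lez_nat sz2.
have K0 : 0 <= K by apply: le_trans rK; rewrite mulr_ge0.
exists (size s1 + size s2)%N.
  rewrite -lez_nat PoszD sz1 sz2; apply: le_trans (lerD ell2 ell2) _.
  by rewrite PoszM -mulrDl.
apply: le_trans (Pr_mid_eq w_ge0 w_indep w_id alS beS s1P s2P al_pL be_pL longs
  eta_small A1 b_gt0 K0 tail y_small aq bq zn L_gt0 Ls1 Ls2 r_ge0 rK gap) _.
apply: (Pr_le w_ge0 (S := setT)).
- exact: (@depends_mid _ n [set y | y = z]).
- exact: (@depends_mid _ n [set y | y.1 = Num.floor (n%:R / 2 + t * n%:R)]).
- by move=> om _ /= ->; exact: z1.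
Qed.

End lower_bound_rate.

(** * The lower bound *)

Section lower_bound.
Context {d : measure_display} {T : measurableType d} {R : realType}.
Variables (P : probability T R) (w : int * int -> {RV P >-> R}).
Hypothesis w_ge0 : forall z x, 0 <= w z x.
Hypothesis w_indep : mutually_independent w.
Hypothesis w_id : identically_distributed w.
Hypothesis w_exp : exists2 alpha : R, 0 < alpha &
  forall z, ('M_P (w z) alpha < +oo)%E.
Hypothesis w_unbounded : forall (z : int * int) (beta : R),
  (0 < P [set x | (beta < w z x)%R])%E.
Variable (mu : R -> R).
Hypothesis mu_shape : is_shape_function w mu.
Variable (J : R -> R -> R).
Hypothesis J_rate : is_upper_tail_rate w J.
Local Notation config := (int * int -> R).
Local Notation Pr := (Pr w).
Implicit Types (t r e eps K : R).

Lemma rate_ge0 t r : - 2^-1 <= t <= 2^-1 -> 0 < r -> 0 <= J t r.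
Proof.
move=> ht r0; apply/ler_addgt0Pr => e e0.
have [N hN] := rate_LP J_rate ht r0 e0.
have /andP[lo _] := hN N.+1 (leqnSn N).
have := le_trans lo (Pr_le1 w_ge0 (@depends_LPT _ _ _ _)).
by rewrite -expR0 ler_expR oppr_le0 pmulr_rge0 // ltr0n.
Qed.

Lemma Pr_weight_ge_gt0 K : 0 < Pr [set om | K <= om origin].
Proof.
have m1 (B : set R) : measurable B -> depends setT [set om : config | B (om origin)].
  exact: depends_coord.
have dK : depends setT [set om : config | K <= om origin].
  rewrite (_ : [set om | _] = [set om | `[K, +oo[%classic (om origin)]).
    exact: m1.
  by apply/seteqP; split => om; rewrite /= in_itv /= andbT.
have dK' : depends setT [set om : config | K < om origin].
  rewrite (_ : [set om | _] = [set om | `]K, +oo[%classic (om origin)]).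
    exact: m1.
  by apply/seteqP; split => om; rewrite /= in_itv /= andbT.
apply: (@lt_le_trans _ _ (Pr [set om | K < om origin])).
  by rewrite -lte_fin -(PrE w dK'); exact: w_unbounded.
by apply: (Pr_le w_ge0 dK' dK) => om _; exact: ltW.
Qed.

(** The order of the choices: the speed [r], the constant [K], the number of
    blocks [q], and only then [n]. *)
Lemma mid_eq_lower t eps : - 2^-1 <= t <= 2^-1 -> 0 < mu 0 -> 0 < eps ->
  exists n0, forall n, (n0 <= n)%N ->
    expR (- 2 * n%:R * (J t (mu 0) + eps)) <=
    Pr [set om | (mid om n).1 = Num.floor (n%:R / 2 + t * n%:R)].
Proof.
move=> ht mu0 eps0.
have eps4 : 0 < eps / 4 by rewrite divr_gt0.
have [del /andP[del0 _] [Jdel _]] :=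
  rate_continuous w_ge0 w_indep w_id J_rate ht mu0 eps4.
set J0 := J t (mu 0) in Jdel *; pose r := mu 0 + del.
have r0 : 0 < r by rewrite addr_gt0.
have [A [b [A1 b0 tail]]] := LP_tail w_ge0 w_indep w_id w_exp.
(* Large enough for the detour ([6 * r]) and for the short bypasses. *)
pose K := 6 * r + 16 * A / b.
have A0 : 0 < A by exact: lt_le_trans A1.
have rK : 6 * r <= K by rewrite lerDl divr_ge0 ?(ltW b0) // mulr_ge0 // ltW.
have y_small : 2 * A * expR (- (b * K / 2)) <= 4^-1.
  rewrite expRN ler_pdivrMr ?expR_gt0 //.
  have := expR_ge1Dx (b * K / 2).
  have -> : b * K / 2 = 3 * (b * r) + 8 * A by rewrite /K; field; rewrite gt_eqF.
  by have : 0 < b * r by [rewrite mulr_gt0]; lra.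
pose pK := Pr [set om | K <= om origin].
have pK0 : 0 < pK by exact: Pr_weight_ge_gt0.
pose lam := `|ln pK|.
have pKE : expR (- lam) <= pK.
  by rewrite -[leRHS]lnK ?posrE // ler_expR lerNl /lam -normrN ler_norm.
(* So many blocks that the heavy weights of the middle part, whose length is
   at most four blocks, cost less than [eps / 2] per unit of [n]. *)
have [q hq] := nat_above (8 * lam / eps).
pose eta : R := (4 * (q.+1 * q.+1)%:R)^-1.
have eta0 : 0 < eta by rewrite invr_gt0 mulr_gt0 // ltr0n.
have eta_small : (q.+1 * q.+1)%:R * eta <= 4^-1.
  by rewrite /eta invfM mulrCA mulfV ?mulr1 // pnatr_eq0.
have [N small] := Pr_LP_small w_ge0 w_indep w_id mu_shape del0 eta0.
have [N1 hN1] := rate_LP J_rate ht r0 eps4.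
have [N2 hN2] := nat_above (2 / eps).
pose Lmin := maxn (maxn N N1) (maxn (2 * q) 1).
exists (maxn N2 (Lmin * q.+1)) => n; rewrite geq_max => /andP[nN2 nL].
pose L := (n %/ q.+1)%N.
have Lq_le : (L * q.+1 <= n)%N by exact: leq_trunc_div.
have Lq_gt : (n < L.+1 * q.+1)%N by exact: ltn_ceil.
have : (Lmin <= L)%N by rewrite leq_divRL.
rewrite !geq_max => /andP[/andP[NL N1L] /andP[q2L L0]].
have [m mL] := Pr_mid_target w_ge0 w_indep w_id ht Lq_le Lq_gt L0 q2L NL
  (ltW r0) rK small eta_small A1 b0 tail y_small.
apply: le_trans.
pose a := J t r + eps / 4.
have a0 : 0 <= a by rewrite addr_ge0 ?rate_ge0 // ltW.
have aJ : a <= J0 + eps / 2 by rewrite /a /r; lra.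
have /andP[pL _] := hN1 L N1L; rewrite -/a in pL.
have nR : 0 <= n%:R :> R by [].
have LqR : L%:R * (q%:R + 1) <= n%:R :> R by rewrite natr1 -natrM ler_nat.
have LR : 0 <= L%:R :> R by [].
have qR : 0 <= q%:R :> R by [].
(* The [2 q] blocks have total length at most [2 n]. *)
have h1 : expR (- (2 * n%:R * a)) <=
    Pr (LP (r * L%:R) origin (endpoint t L)) ^+ (2 * q).
  apply: (@le_trans _ _ (expR (- (L%:R * a)) ^+ (2 * q))); last first.
    by apply: lerXn2r; rewrite ?nnegrE ?expR_ge0 ?Pr_ge0.
  rewrite -expRM_natl ler_expR natrM.
  have : L%:R * q%:R * a <= n%:R * a by apply: ler_wpM2r => //; lra.
  by lra.
(* The choice of [q] makes [4 lam L] at most [n eps / 2]. *)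
have h2 : expR (- (n%:R * eps / 2)) <= pK ^+ m.
  apply: (@le_trans _ _ (expR (- lam) ^+ m)); last first.
    by apply: lerXn2r; rewrite ?nnegrE ?expR_ge0 ?Pr_ge0.
  rewrite -expRM_natl ler_expR mulrN lerN2.
  have lam0 : 0 <= lam by exact: normr_ge0.
  apply: (@le_trans _ _ ((4 * L)%:R * lam)).
    by apply: ler_wpM2r => //; rewrite ler_nat.
  have : 8 * lam <= q%:R * eps by rewrite -ler_pdivrMr.
  move=> hlam; have h : L%:R * (8 * lam) <= L%:R * (q%:R * eps) by exact: ler_wpM2l.
  have h' : L%:R * (q%:R + 1) * eps <= n%:R * eps by apply: ler_wpM2r => //; exact: ltW.
  have h'' : 0 <= L%:R * eps by rewrite mulr_ge0 // ltW.
  by rewrite natrM; lra.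
have h3 : expR (- (n%:R * eps / 2)) <= 2^-1.
  rewrite expRN lef_pV2 ?posrE ?expR_gt0 //.
  have := expR_ge1Dx (n%:R * eps / 2).
  have : 2 <= n%:R * eps.
    by rewrite -ler_pdivrMr //; apply: (le_trans hN2); rewrite ler_nat.
  by lra.
apply: (@le_trans _ _ (expR (- (2 * n%:R * a)) * expR (- (n%:R * eps / 2)) *
    expR (- (n%:R * eps / 2)))).
  rewrite -!expRD ler_expR.
  have : n%:R * a <= n%:R * (J0 + eps / 2) by apply: ler_wpM2l.
  by lra.
apply: ler_pM; rewrite ?mulr_ge0 ?expR_ge0 //.
by apply: ler_pM; rewrite ?expR_ge0.
Qed.

End lower_bound.

(** * The rates of the midpoint probabilities *)

Theorem theorem1p1 (d : measure_display) (T : measurableType d) (R : realType)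
    (P : probability T R) (w : int * int -> {RV P >-> R})
    (w_indep : mutually_independent w)
    (w_id : identically_distributed w)
    (w_ge0 : forall z x, 0 <= w z x)
    (w_cont : forall z, continuous (cdf (w z)))
    (w_exp : exists2 alpha : R, 0 < alpha &
       forall z, ('M_P (w z) alpha < +oo)%E)
    (w_unbounded : forall (z : int * int) (beta : R),
       (0 < P [set x | (beta < w z x)%R])%E)
    (mu : R -> R) (mu_shape : is_shape_function w mu)
    (J : R -> R -> R) (J_rate : is_upper_tail_rate w J)
    (t : R) (t_gt0 : 0 < t) (t_le : t <= 2^-1) (mu_gt : mu t < mu 0) :
  let mid_eq (n : nat) :=
    P [set x | (mid (weights w x) n).1 = Num.floor (n%:R / 2 + t * n%:R)] in
  let mid_ge (n : nat) :=
    P [set x | Num.floor (n%:R / 2 + t * n%:R) <= (mid (weights w x) n).1] in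
  [/\ forall eps : R, 0 < eps -> exists n0 : nat, forall n : nat,
        (n0 <= n)%N -> ~~ odd n ->
        [/\ ((expR (- 2 * n%:R * (J t (mu 0) + eps)))%:E <= mid_eq n)%E,
            (mid_eq n <= mid_ge n)%E &
            (mid_ge n <= (expR (- 2 * n%:R * (J t (mu 0) - eps)))%:E)%E],
      (- (((k.*2)%:R^-1)%:E * lne (mid_eq k.*2)))%E @[k --> \oo]
        --> (2 * J t (mu 0))%:E
    & (- (((k.*2)%:R^-1)%:E * lne (mid_ge k.*2)))%E @[k --> \oo]
        --> (2 * J t (mu 0))%:E].
Proof.
have mut0 : 0 <= mu t by apply: (shape_ge0 w_ge0 mu_shape); apply/andP; split; lra.
have mu0 : 0 < mu 0 by exact: le_lt_trans mu_gt.
have ht : - 2^-1 <= t <= 2^-1 by apply/andP; split; lra.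
pose a n := Num.floor (n%:R / 2 + t * n%:R).
pose pe n := Pr w [set om | (mid om n).1 = a n].
pose pg n := Pr w [set om | a n <= (mid om n).1].
have de n : depends setT [set om : int * int -> R | (mid om n).1 = a n].
  exact: (@depends_mid _ n [set y | y.1 = a n]).
have dg n : depends setT [set om : int * int -> R | a n <= (mid om n).1].
  exact: (@depends_mid _ n [set y | a n <= y.1]).
have peg n : pe n <= pg n.
  by apply: (Pr_le w_ge0 (de n) (dg n)) => om _ /= ->.
have bounds eps : 0 < eps -> exists n0 : nat, forall n, (n0 <= n)%N -> ~~ odd n ->
    expR (- 2 * n%:R * (J t (mu 0) + eps)) <= pe n /\
    pg n <= expR (- 2 * n%:R * (J t (mu 0) - eps)).
  move=> eps0.
  have [n1 h1] := mid_eq_lower w_ge0 w_indep w_id w_exp w_unbounded mu_shape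
    J_rate ht mu0 eps0.
  have [n2 h2] := mid_ge_upper w_ge0 w_indep w_id mu_shape J_rate t_gt0 t_le mu0 eps0.
  exists (maxn n1 n2) => n; rewrite geq_max => /andP[/h1 lo /h2 hi] /hi.
  by split.
have rate (p : nat -> R) : (forall n, 0 <= p n) -> (forall n, pe n <= p n <= pg n) ->
    (- (((k.*2)%:R^-1)%:E * lne (p k.*2)%:E))%E @[k --> \oo]
      --> (2 * J t (mu 0))%:E.
  move=> p0 pp; apply: (@rate_cvg R double (fun k => p k.*2)) => //.
    by move=> k; rewrite double_gt0.
  move=> e e0; have e20 : 0 < e / 2 by rewrite divr_gt0.
  have [n0 hn] := bounds _ e20; exists n0 => k kn.
  have [||lo hi] := hn k.*2; first by rewrite (leq_trans kn) // -addnn leq_addr.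
    by rewrite odd_double.
  have /andP[pl pu] := pp k.*2.
  apply/andP; split; [apply: le_trans pl|apply: (le_trans pu)].
    by apply: le_trans lo; rewrite ler_expR; lra.
  by apply: (le_trans hi); rewrite ler_expR; lra.
move=> mid_eq mid_ge.
have eE n : mid_eq n = (pe n)%:E by exact: PrE (de n).
have gE n : mid_ge n = (pg n)%:E by exact: PrE (dg n).
split.
- move=> eps eps0; have [n0 hn] := bounds eps eps0; exists n0 => n nn ev.
  have [lo hi] := hn n nn ev.
  by rewrite eE gE !lee_fin.
- under eq_fun do rewrite eE.
  by apply: rate => n; [exact: Pr_ge0|rewrite lexx peg].
- under eq_fun do rewrite gE.
  by apply: rate => n; [exact: Pr_ge0|rewrite lexx peg].
Qed.
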